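(* Let $H_1$ and $H_2$ be free groups, each of rank $2$, let $M$ be a free group equipped with injective homomorphisms $M\hookrightarrow H_1$ and $M\hookrightarrow H_2$, and let $G=H_1*_M H_2$ be the corresponding amalgamated free product. If there exists a surjective homomorphism $G\to\mathbb{F}_3$, where $\mathbb{F}_3$ denotes the free group of rank $3$, then $M$ is cyclic or trivial.
   Context: The amalgamated product $H_1*_M H_2$ is the fundamental group of the graph of free groups with two vertices, carrying the vertex groups $H_1$ and $H_2$, and one edge joining them, carrying the edge group $M$. The surjection $G\to\mathbb{F}_3$ is not assumed to be injective on $H_1$, $H_2$ or $M$. *)

(* Defs.v *)
From mathcomp Require Import all_boot.

Set Implicit Arguments.
Unset Strict Implicit.
Unset Printing Implicit Defensive.

Local Open Scope group_scope.

(* e : X -> G exhibits G as the free group on X, by the universal property.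
   Morphisms into a group K are compared pointwise. Since K is a group, a
   multiplicative map automatically preserves 1 and inverses. *)
Definition free_basis (G : groupType) (X : Type) (e : X -> G) : Prop :=
  forall (K : groupType) (f : X -> K),
    (exists phi : {multiplicative G -> K}, forall x, phi (e x) = f x) /\
    (forall phi psi : {multiplicative G -> K},
       (forall x, phi (e x) = f x) -> (forall x, psi (e x) = f x) ->
       phi =1 psi).

Definition free_group (G : groupType) : Prop :=
  exists (X : Type) (e : X -> G), free_basis e.

Definition free_group_of_rank (n : nat) (G : groupType) : Prop :=
  exists e : 'I_n -> G, free_basis e.

(* G = H1 *_M H2 : the square j1 \o i1 = j2 \o i2 is a pushout of groups. *)
Definition amalgamated_product (M H1 H2 G : groupType)
    (i1 : {multiplicative M -> H1}) (i2 : {multiplicative M -> H2})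
    (j1 : {multiplicative H1 -> G}) (j2 : {multiplicative H2 -> G}) : Prop :=
  (forall m, j1 (i1 m) = j2 (i2 m)) /\
  forall (K : groupType)
         (f1 : {multiplicative H1 -> K}) (f2 : {multiplicative H2 -> K}),
    (forall m, f1 (i1 m) = f2 (i2 m)) ->
    (exists phi : {multiplicative G -> K},
       (forall x, phi (j1 x) = f1 x) /\ (forall y, phi (j2 y) = f2 y)) /\
    (forall phi psi : {multiplicative G -> K},
       (forall x, phi (j1 x) = f1 x) -> (forall y, phi (j2 y) = f2 y) ->
       (forall x, psi (j1 x) = f1 x) -> (forall y, psi (j2 y) = f2 y) ->
       phi =1 psi).

Definition surjective_map (A B : Type) (f : A -> B) : Prop :=
  forall b, exists a, f a = b.

Definition trivial_group (G : groupType) : Prop := forall x : G, x = 1.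

(* Every element is an integer power of g, written with natural exponents. *)
Definition cyclic_group (G : groupType) : Prop :=
  exists g : G, forall x : G, exists n : nat, x = g ^+ n \/ x = g ^- n.

(* Main.v *)
From HB Require Import structures.
Require Import Defs.
From mathcomp Require Import all_boot all_algebra all_fingroup zify.
From Stdlib Require Import Classical ClassicalEpsilon.
Import GRing.Theory.

(** Let p map G onto F3, and let f1 : H1 -> F3 and f2 : H2 -> F3 be its
    restrictions to the vertex groups; their images K1 and K2 together generate
    F3. The point is that M must be commutative: counting ranks in homology
    modulo 2 shows that K1 and K2 are too small to generate a group of rank 3
    as soon as two elements of M do not commute. A commutative free group is
    trivial or infinite cyclic [commutative_free_cyclic].

    Stallings folding presents Ki as the set of labels of the closed walks of a
    finite connected folded graph Xi. Folding starts from two subdivided petals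
    around a vertex, where |E| = |V| + 1. A fold identifies two edges, and either
    identifies two vertices as well, in which case it is a homotopy equivalence,
    or does not, in which case |E| - |V| drops. Hence |E| <= |V| + 1 at the end,
    and if equality holds then Xi still has the fundamental group of the initial
    graph, so that fi is injective [stallings_graph].

    If neither f1 nor f2 is injective, then |E| <= |V| for both graphs, and two
    connected graphs with first Betti number at most 1 cannot account for the
    three dimensions of the homology of F3.

    Otherwise M embeds in F3, and two elements of M that do not commute give two
    closed walks with non-commuting labels in the fibre product of X1 and X2.
    The part C of the fibre product that they visit has at least two exits at
    each vertex and at least three at some vertex [branching_set]. Now glue X1
    and X2 along C. Let r0 and r1 be the numbers of independent identifications
    of vertices and of edges. The glued chain complex has first Betti number
    |E1| + |E2| - |V1| - |V2| - (r1 - r0) + 1, which is at least 3 because K1 and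
    K2 generate F3 [rank_bound]. But r1 > r0 because C branches
    [branching_relations], so this number is at most 2: a contradiction. *)

Set Implicit Arguments.
Unset Strict Implicit.
Unset Printing Implicit Defensive.

Local Open Scope group_scope.

(** * Free groups as groups of reduced words *)

Section MultiplicativeGroupMaps.
Variables (G K : groupType) (phi : {multiplicative G -> K}).

Lemma mult1 : phi 1 = 1.
Proof. by apply: (@mulgI K (phi 1)); rewrite -gmulfM !mulg1. Qed.

Lemma multV : {morph phi : x / x^-1}.
Proof. by move=> x; apply: (@mulIg K (phi x)); rewrite -gmulfM !mulVg mult1. Qed.

Lemma mult_inj : (forall x, phi x = 1 -> x = 1) -> injective phi.
Proof.
by move=> ker1 x y eq_xy; apply/divg1_eq/ker1; rewrite gmulfM multV eq_xy mulgV.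
Qed.

End MultiplicativeGroupMaps.

Notation letter X := (X * bool)%type.

(** The flag of a letter tells a generator from its inverse, so that [flip] is
    formal inversion. *)
Definition flip (X : Type) (l : letter X) : letter X := (l.1, ~~ l.2).

Lemma flipK (X : Type) : involutive (@flip X).
Proof. by case=> x []. Qed.

Lemma flip_neq (X : eqType) (l : letter X) : (flip l == l) = false.
Proof. by apply/negbTE/eqP; case: l => x [] []. Qed.

Definition inv_word (X : Type) (s : seq (letter X)) : seq (letter X) :=
  rev (map (@flip X) s).

Definition reduced (X : eqType) (s : seq (letter X)) : bool :=
  sorted (fun a b => b != flip a) s.

Lemma reduced_behead (X : eqType) (l : letter X) s :
  reduced (l :: s) -> reduced s.
Proof. exact: path_sorted. Qed.

Lemma reduced_inv (X : eqType) (s : seq (letter X)) :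
  reduced (inv_word s) = reduced s.
Proof.
rewrite /reduced /inv_word rev_sorted sorted_map; apply: eq_sorted => a b /=.
by rewrite flipK eq_sym.
Qed.

(** Left multiplication by a letter acts on reduced words by a permutation, with
    inverse the action of the opposite letter. The group law of reduced words is
    defined through this action, and associativity comes down to [mul_push]. *)
Definition push_letter (X : eqType) (l : letter X) (s : seq (letter X)) :=
  if s is h :: s' then if h == flip l then s' else l :: s else [:: l].

Lemma push_reduced (X : eqType) (l : letter X) s :
  reduced s -> reduced (push_letter l s).
Proof.
case: s => // h s' redhs /=; case: ifPn => [_|nh]; first exact: reduced_behead redhs.
by rewrite /reduced /= nh.
Qed.

Lemma push_reducedE (X : eqType) (l : letter X) s :
  reduced (l :: s) -> push_letter l s = l :: s.
Proof. by case: s => // h s' /= /andP[/negbTE->]. Qed.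

Lemma pushK (X : eqType) (l : letter X) s :
  reduced s -> push_letter l (push_letter (flip l) s) = s.
Proof.
case: s => [|h s'] /=; first by rewrite eqxx.
rewrite flipK; case: (eqVneq h l) => [->|_] redhs; first exact: push_reducedE.
by rewrite /= eqxx.
Qed.

Lemma pushVK (X : eqType) (l : letter X) s :
  reduced s -> push_letter (flip l) (push_letter l s) = s.
Proof. by move=> reds; rewrite -{2}[l]flipK pushK. Qed.

Definition mul_word (X : eqType) (s t : seq (letter X)) :=
  foldr (@push_letter X) t s.

Lemma mul_word_reduced (X : eqType) (s t : seq (letter X)) :
  reduced t -> reduced (mul_word s t).
Proof. by move=> redt; elim: s => //= l s; apply: push_reduced. Qed.

Lemma mul_push (X : eqType) (l : letter X) s t :
  reduced s -> reduced t ->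
  mul_word (push_letter l s) t = push_letter l (mul_word s t).
Proof.
case: s => //= h s' redhs redt; case: ifP => //= /eqP->.
by rewrite pushK ?mul_word_reduced.
Qed.

Lemma mul_wordA (X : eqType) (s t r : seq (letter X)) :
  reduced t -> reduced r ->
  mul_word s (mul_word t r) = mul_word (mul_word s t) r.
Proof.
by move=> redt redr; elim: s => //= l s ->; rewrite mul_push ?mul_word_reduced.
Qed.

Lemma mul_word0 (X : eqType) (s : seq (letter X)) :
  reduced s -> mul_word s [::] = s.
Proof.
by elim: s => //= l s IHs reds; rewrite IHs ?push_reducedE ?(reduced_behead reds).
Qed.

Lemma mul_word_inv (X : eqType) (s t : seq (letter X)) :
  reduced t -> mul_word (inv_word s) (mul_word s t) = t.
Proof.
move=> redt; elim: s => //= l s IHs.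
rewrite /inv_word /= rev_cons /mul_word foldr_rcons pushVK //.
exact: mul_word_reduced.
Qed.

Lemma mul_wordV (X : eqType) (s : seq (letter X)) :
  reduced s -> mul_word (inv_word s) s = [::].
Proof. by move=> reds; rewrite -{2}(mul_word0 reds) mul_word_inv. Qed.

Lemma inv_wordK (X : Type) : involutive (@inv_word X).
Proof.
by move=> s; rewrite /inv_word map_rev revK (mapK (@flipK X)).
Qed.

Section ReducedWordGroup.
Variable X : choiceType.

Record rword := RWord { rword_val :> seq (letter X); rwordP : reduced rword_val }.

HB.instance Definition _ := [isSub for rword_val].
HB.instance Definition _ := [Choice of rword by <:].

Definition rword_mul (s t : rword) := RWord (mul_word_reduced s (rwordP t)).
Definition rword_one := @RWord [::] isT.
Definition rword_inv (s : rword) : rword :=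
  RWord (etrans (reduced_inv s) (rwordP s)).

Lemma rword_mulA : associative rword_mul.
Proof. by move=> s t r; apply/val_inj/mul_wordA; apply: rwordP. Qed.
Lemma rword_mul1g : left_id rword_one rword_mul.
Proof. by move=> s; apply/val_inj. Qed.
Lemma rword_mulg1 : right_id rword_one rword_mul.
Proof. by move=> s; apply/val_inj/mul_word0/rwordP. Qed.
Lemma rword_mulVr : left_inverse rword_one rword_inv rword_mul.
Proof. by move=> s; apply/val_inj/mul_wordV/rwordP. Qed.
Lemma rword_mulrV : right_inverse rword_one rword_inv rword_mul.
Proof.
move=> s; apply/val_inj; rewrite /= -{1}[val s]inv_wordK.
by apply: mul_wordV; rewrite reduced_inv; apply: rwordP.
Qed.

HB.instance Definition _ := isGroup.Build rword rword_mulA rword_mul1g rword_mulg1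
   rword_mulVr rword_mulrV.
End ReducedWordGroup.

Definition letter_value (X : Type) (G : groupType) (e : X -> G) (l : letter X) : G :=
  if l.2 then e l.1 else (e l.1)^-1.

Definition word_value (X : Type) (G : groupType) (e : X -> G)
  (s : seq (letter X)) : G := foldr (fun l g => letter_value e l * g) 1 s.

Section WordValue.
Variables (X : Type) (G : groupType) (e : X -> G).

Lemma letter_value_flip l : letter_value e (flip l) = (letter_value e l)^-1.
Proof. by case: l => x [] //=; rewrite /letter_value /= invgK. Qed.

Lemma word_value_cat s t :
  word_value e (s ++ t) = word_value e s * word_value e t.
Proof. by elim: s => [|l s IHs] /=; rewrite ?mul1g // IHs mulgA. Qed.

Lemma word_value_inv s : word_value e (inv_word s) = (word_value e s)^-1.
Proof.
elim: s => [|l s IHs] /=; first by rewrite invg1.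
rewrite /inv_word /= rev_cons -cats1 word_value_cat IHs /= mulg1 invgM.
by rewrite letter_value_flip.
Qed.

End WordValue.

Lemma word_value_push (X : eqType) (G : groupType) (e : X -> G) l s :
  word_value e (push_letter l s) = letter_value e l * word_value e s.
Proof.
case: s => //= h s; case: ifP => //= /eqP->.
by rewrite letter_value_flip mulVKg.
Qed.

Lemma word_value_mul (X : eqType) (G : groupType) (e : X -> G) s t :
  word_value e (mul_word s t) = word_value e s * word_value e t.
Proof. by elim: s => [|l s IHs] /=; rewrite ?mul1g // word_value_push IHs mulgA. Qed.

Section FreeBasis.
Variables (X : choiceType) (G : groupType) (e : X -> G).
Hypothesis free_e : free_basis e.

Definition rword_value (s : rword X) : G := word_value e s.

HB.instance Definition _ := isMultiplicative.Build (rword X) G rword_value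
   (fun s t => word_value_mul e s t).

Definition rword_letter (x : X) : rword X := @RWord X [:: (x, true)] isT.

(** Evaluating the image in the group of reduced words is an endomorphism that
    fixes the basis, hence is the identity. *)
Lemma free_basis_surj g : exists2 s, reduced s & g = word_value e s.
Proof.
have [phi phiE] := (free_e rword_letter).1.
exists (phi g); first exact: rwordP.
have idE := (free_e e).2 idfun (rword_value \o phi).
by apply: idE => x //=; rewrite phiE /rword_value /= mulg1.
Qed.

(** The map to the group of reduced words sends the value of a reduced word back
    to that word. *)
Lemma free_basis_inj s t :
  reduced s -> reduced t -> word_value e s = word_value e t -> s = t.
Proof.
have [phi phiE] := (free_e rword_letter).1.
have phi_letter l : val (phi (letter_value e l)) = [:: l].
  case: l => x []; rewrite /letter_value /=.
    by rewrite phiE.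
  by rewrite multV phiE.
have phi_word r : reduced r -> val (phi (word_value e r)) = r.
  elim: r => [|l r IHr] redr /=; first by rewrite mult1.
  rewrite gmulfM /= phi_letter /= IHr ?(reduced_behead redr) //.
  exact: push_reducedE.
by move=> reds redt eq_st; rewrite -(phi_word s) // eq_st phi_word.
Qed.

End FreeBasis.

(** * Marked graphs and their walks *)

(** Edges carry two labels. The letters [lab] spell words in a basis of the
    target group F of a map f : H -> F, and the marks in H keep track of the
    element of H that a closed walk represents. The marks identify the
    fundamental group with H as long as no fold creates a relation. *)
Record marked_graph (L H : Type) := MarkedGraph {
  vert : finType;
  edge : finType;
  src : edge -> vert;
  tgt : edge -> vert;
  lab : edge -> L;
  mark : edge -> H;
  base : vert
}.

Section Walks.
Variables (L : Type) (H : groupType) (X : marked_graph L H).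

(* A dart (x, b) is the edge x run forwards or backwards according to b, so that
   darts are letters over the edges, and reduction of words is the removal of
   backtracking. *)
Definition dsrc (d : letter (edge X)) := if d.2 then src d.1 else tgt d.1.
Definition dtgt (d : letter (edge X)) := dsrc (flip d).
Definition dlab (d : letter (edge X)) : letter L := (lab d.1, d.2).

Fixpoint walk (v : vert X) (ds : seq (letter (edge X))) (w : vert X) : bool :=
  if ds is d :: ds' then (dsrc d == v) && walk (dtgt d) ds' w else v == w.

Lemma dtgt_flip d : dtgt (flip d) = dsrc d.
Proof. by rewrite /dtgt flipK. Qed.

Lemma walk_cat u v w ds ds' :
  walk u ds v -> walk v ds' w -> walk u (ds ++ ds') w.
Proof.
elim: ds u => [|d ds IHds] u /=; first by move/eqP->.
by case/andP=> -> /IHds; apply.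
Qed.

Lemma walk_inv u v ds : walk u ds v -> walk v (inv_word ds) u.
Proof.
elim: ds u => [|d ds IHds] u /=; first by rewrite eq_sym.
case/andP=> /eqP<- /IHds walk_ds; rewrite /inv_word /= rev_cons -cats1.
by apply: walk_cat walk_ds _; rewrite /= dtgt_flip !eqxx.
Qed.

Lemma walk_push d ds w :
  walk (dtgt d) ds w -> walk (dsrc d) (push_letter d ds) w.
Proof.
case: ds => [|c ds] /=; first by rewrite eqxx.
case: ifP => [/eqP->|_ walk_cds] /=; first by rewrite dtgt_flip => /andP[].
by rewrite eqxx walk_cds.
Qed.

Lemma walk_reduce v ds w : walk v ds w -> walk v (mul_word ds [::]) w.
Proof.
elim: ds v => //= d ds IHds v /andP[/eqP<- /IHds].
exact: walk_push.
Qed.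

Definition loop_value (h : H) : Prop :=
  exists2 ds, walk (base X) ds (base X) & word_value (@mark _ _ X) ds = h.

Definition connected_graph := forall v, exists ds, walk (base X) ds v.

Definition folded_graph :=
  forall d d', dsrc d = dsrc d' -> dlab d = dlab d' -> d = d'.

Lemma loop_value_word (Y : Type) (y : Y -> H) s :
  (forall i, loop_value (y i)) -> loop_value (word_value y s).
Proof.
move=> loop_y; elim: s => [|[i b] s [ds walk_ds ds_val]] /=; first by exists [::] => /=.
have [cs walk_cs cs_val] := loop_y i.
exists ((if b then cs else inv_word cs) ++ ds); last first.
  by rewrite word_value_cat ds_val /letter_value; case: b; rewrite ?word_value_inv cs_val.
by apply: walk_cat walk_ds; case: b => //; apply: walk_inv.
Qed.

End Walks.

(** In a folded graph a walk that does not backtrack spells a reduced word: two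
    inverse letters in a row would be a dart followed by its reverse. *)
Lemma folded_reduced (L : eqType) (H : groupType) (X : marked_graph L H) v ds w :
  folded_graph X -> walk v ds w -> reduced ds -> reduced (map (@dlab _ _ X) ds).
Proof.
move=> foldX; elim: ds v => [|d [|c ds] IHds] v //=.
move=> /andP[_ /[dup]/andP[/eqP src_c _] walk_cds].
rewrite /reduced /= => /andP[c_neq redds]; apply/andP; split; last exact: IHds walk_cds redds.
by apply: contraNneq c_neq => lab_c; apply/eqP/foldX.
Qed.

(** A map of graphs may change the marks by a gauge k : vert X -> K, that is, by a
    change of trivialisation at each vertex. Values of closed walks at the base
    vertex do not change if the gauge is trivial there. *)
Section Morphisms.
Variables (L : Type) (H K : groupType) (f : {multiplicative H -> K}).
Variables (X : marked_graph L H) (Y : marked_graph L K).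
Variables (q : vert X -> vert Y) (r : edge X -> edge Y) (k : vert X -> K).
Hypotheses (src_r : forall x, src (r x) = q (src x))
           (tgt_r : forall x, tgt (r x) = q (tgt x))
           (mark_r : forall x, mark (r x) = k (src x) * f (mark x) * (k (tgt x))^-1).

Let rd (d : letter (edge X)) : letter (edge Y) := (r d.1, d.2).

Lemma morph_walk u ds v : walk u ds v -> walk (q u) (map rd ds) (q v).
Proof.
elim: ds u => [|d ds IHds] u /=; first by move/eqP->.
case/andP=> /eqP<- /IHds; case: d => x [] /=;
  rewrite /dtgt /dsrc /= ?src_r ?tgt_r eqxx; exact.
Qed.

Lemma morph_value u ds v : walk u ds v ->
  word_value (@mark _ _ Y) (map rd ds) =
  k u * f (word_value (@mark _ _ X) ds) * (k v)^-1.
Proof.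
elim: ds u => [|d ds IHds] u /=.
  by move/eqP->; rewrite mult1 mulg1 mulgV.
case/andP=> /eqP<- /IHds->; rewrite gmulfM !mulgA; congr (_ * _ * _).
case: d => x [] /=; rewrite /letter_value /dtgt /dsrc /= mark_r ?multV.
  by rewrite mulgVK.
by rewrite !invgM invgK !mulgA mulgVK.
Qed.

Hypotheses (q_base : q (base X) = base Y) (k_base : k (base X) = 1).

Lemma morph_loop h : loop_value X h -> loop_value Y (f h).
Proof.
case=> ds walk_ds <-; exists (map rd ds); first by rewrite -q_base morph_walk.
by rewrite (morph_value walk_ds) k_base mul1g invg1 mulg1.
Qed.

Lemma morph_connected :
  (forall w, exists v, q v = w) -> connected_graph X -> connected_graph Y.
Proof.
move=> q_surj connX w; have [v <-] := q_surj w; have [ds walk_ds] := connX v.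
by exists (map rd ds); rewrite -q_base morph_walk.
Qed.

End Morphisms.

Section Development.
Variables (L : Type) (F : groupType) (e : L -> F).

Section Developed.
Variables (H : groupType) (f : {multiplicative H -> F}) (X : marked_graph L H).

(** The potential g develops the universal cover of X in F: it makes the marks
    and the letters compatible with f, up to a coboundary. *)
Definition developed_by (g : vert X -> F) : Prop :=
  g (base X) = 1 /\
  forall x : edge X, f (mark x) = g (src x) * e (lab x) * (g (tgt x))^-1.

Definition developed := exists g, developed_by g.

Lemma developed_walk g u ds v : developed_by g -> walk u ds v ->
  f (word_value (@mark _ _ X) ds) =
  g u * word_value e (map (@dlab _ _ X) ds) * (g v)^-1.
Proof.
case=> _ gE; elim: ds u => [|d ds IHds] u /=.
  by move/eqP->; rewrite mult1 mulg1 mulgV.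
case/andP=> /eqP<- /IHds walkE; rewrite gmulfM walkE !mulgA; congr (_ * _ * _).
case: d {walkE} => x [] /=; rewrite /letter_value /dtgt /dsrc /= ?multV gE.
  by rewrite mulgVK.
by rewrite !invgM invgK !mulgA mulgVK.
Qed.

Lemma developed_loop ds : developed -> walk (base X) ds (base X) ->
  f (word_value (@mark _ _ X) ds) = word_value e (map (@dlab _ _ X) ds).
Proof.
case=> g dev_g walk_ds; rewrite (developed_walk dev_g walk_ds) dev_g.1.
by rewrite mul1g invg1 mulg1.
Qed.

End Developed.

Definition push_marks (H : groupType) (f : H -> F) (X : marked_graph L H) :=
  @MarkedGraph L F _ _ (@src _ _ X) (@tgt _ _ X) (@lab _ _ X)
     (fun x => f (mark x)) (base X).

Section PushMarks.
Variables (H : groupType) (f : {multiplicative H -> F}) (X : marked_graph L H).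

Lemma push_developed : developed f X -> developed idfun (push_marks f X).
Proof. by []. Qed.

Lemma push_connected : connected_graph X -> connected_graph (push_marks f X).
Proof. by []. Qed.

Lemma push_loop h : loop_value X h -> loop_value (push_marks f X) (f h).
Proof.
apply: (@morph_loop _ _ _ f X (push_marks f X) id id (fun=> 1)) => // x.
by rewrite mul1g invg1 mulg1.
Qed.

End PushMarks.

Section Delete.
Variables (H : groupType) (f : {multiplicative H -> F}) (X : marked_graph L H).
Variables (x0 x1 : edge X).
Hypotheses (x10 : x1 != x0) (src_x : src x0 = src x1) (tgt_x : tgt x0 = tgt x1).
Hypotheses (mark_x : mark x0 = mark x1).

Definition delete_edge :=
  @MarkedGraph L H (vert X) {x | x != x0} (fun x => src (val x))
    (fun x => tgt (val x)) (fun x => lab (val x)) (fun x => mark (val x)) (base X).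

Let r : edge X -> edge delete_edge := insubd (exist _ x1 x10).

Let val_r x : val (r x) = if x == x0 then x1 else x.
Proof. by rewrite /r val_insubd /=; case: eqP. Qed.

Lemma delete_developed : developed f X -> developed f delete_edge.
Proof. by case=> g [g1 gE]; exists g; split=> // x; apply: gE. Qed.

Let rsrc x : src (r x) = src x.
Proof. by rewrite /= val_r; case: eqP => // ->. Qed.
Let rtgt x : tgt (r x) = tgt x.
Proof. by rewrite /= val_r; case: eqP => // ->. Qed.
Let rmark x : mark (r x) = 1 * idfun (mark x) * 1^-1.
Proof. by rewrite invg1 mul1g mulg1 /= val_r; case: eqP => // ->. Qed.

Lemma delete_connected : connected_graph X -> connected_graph delete_edge.
Proof.
apply: (@morph_connected _ _ _ X delete_edge id r) => // w.
by exists w.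
Qed.

Lemma delete_loop h : loop_value X h -> loop_value delete_edge h.
Proof. exact: (@morph_loop _ _ _ idfun X delete_edge id r (fun=> 1)). Qed.

Lemma card_delete : #|edge delete_edge|.+1 = #|edge X|.
Proof.
rewrite card_sig (eq_card (B := predC1 x0)) // cardC1 prednK //.
by apply/card_gt0P; exists x0.
Qed.

End Delete.

(** Identifying the vertex t' with t. The marks are changed by a gauge supported
    at t' whose value a must map to the difference of the potentials at t and t',
    so that the potential descends to the quotient. *)
Section Merge.
Variables (H : groupType) (f : {multiplicative H -> F}) (X : marked_graph L H).
Variables (t t' : vert X) (a : H).
Hypotheses (t_neq : t != t') (t'_base : base X != t').

Definition collapse : vert X -> {v | v != t'} := insubd (exist _ t t_neq).

Definition collapse_gauge (v : vert X) : H := if v == t' then a else 1.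

Definition merge_vertices :=
  @MarkedGraph L H {v | v != t'} (edge X)
    (fun x => collapse (src x)) (fun x => collapse (tgt x)) (@lab _ _ X)
    (fun x => collapse_gauge (src x) * mark x * (collapse_gauge (tgt x))^-1)
    (collapse (base X)).

Lemma val_collapse v : val (collapse v) = if v == t' then t else v.
Proof. by rewrite /collapse val_insubd /=; case: eqP. Qed.

Lemma collapse_gauge_base : collapse_gauge (base X) = 1.
Proof. by rewrite /collapse_gauge (negbTE t'_base). Qed.

Lemma merge_developed g : developed_by f g -> f a = g t * (g t')^-1 ->
  developed f merge_vertices.
Proof.
case=> g1 gE aE; exists (g \o val); split=> [|x] /=.
  by rewrite val_collapse (negbTE t'_base).
have gaugeE v : g (val (collapse v)) = f (collapse_gauge v) * g v.
  rewrite val_collapse /collapse_gauge; case: eqP => [->|_].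
    by rewrite aE mulgVK.
  by rewrite mult1 mul1g.
by rewrite !gaugeE !gmulfM multV gE invgM !mulgA.
Qed.

Lemma merge_connected : connected_graph X -> connected_graph merge_vertices.
Proof.
apply: (@morph_connected _ _ _ X merge_vertices collapse id) => // w.
by exists (val w); apply: val_inj; rewrite val_collapse (negbTE (valP w)).
Qed.

Lemma merge_loop h : loop_value X h -> loop_value merge_vertices h.
Proof.
apply: (@morph_loop _ _ _ idfun X merge_vertices collapse id collapse_gauge) => //.
exact: collapse_gauge_base.
Qed.

Lemma merge_closes ds : base X = t -> walk (base X) ds t' ->
  loop_value merge_vertices (word_value (@mark _ _ X) ds * a^-1).
Proof.
move=> baset walk_ds; exists (map (fun d => (d.1, d.2)) ds).
  have := @morph_walk _ _ _ X merge_vertices collapse id _ _ _ _ _ walk_ds.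
  suff <- : collapse (base X) = collapse t' by apply.
  by apply: val_inj; rewrite !val_collapse eqxx (negbTE t'_base).
rewrite (@morph_value _ _ _ idfun X merge_vertices id collapse_gauge _ _ _ _ walk_ds) //.
by rewrite collapse_gauge_base mul1g /collapse_gauge eqxx.
Qed.

Lemma card_merge : #|vert merge_vertices|.+1 = #|vert X|.
Proof.
rewrite card_sig (eq_card (B := predC1 t')) // cardC1 prednK //.
by apply/card_gt0P; exists t'.
Qed.

End Merge.

End Development.

(** * Stallings folding *)

Section Folding.
Variables (L : choiceType) (F : groupType) (e : L -> F).

Lemma dart_developed (H : groupType) (f : {multiplicative H -> F})
    (X : marked_graph L H) g (d : letter (edge X)) : developed_by e f g ->
  f (letter_value (@mark _ _ X) d) =
  g (dsrc d) * letter_value e (dlab d) * (g (dtgt d))^-1.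
Proof.
move=> dev_g; have walk_d : walk (dsrc d) [:: d] (dtgt d) by rewrite /= !eqxx.
by have := developed_walk dev_g walk_d; rewrite /= !mulg1.
Qed.

(** Two darts with the same source and letter can be identified. If their targets
    differ, one gauge change makes the two marks equal and the markings in H
    survive. If their targets agree, the two marks may differ by an element of
    the kernel of f, so the marks are first pushed to F, where they agree; the
    number of edges then drops while that of vertices does not. *)
Lemma fold_step (H : groupType) (f : {multiplicative H -> F})
    (X : marked_graph L H) (d d' : letter (edge X)) :
  developed e f X -> connected_graph X ->
  d != d' -> dsrc d = dsrc d' -> dlab d = dlab d' ->
  (exists Y : marked_graph L H,
     [/\ developed e f Y, connected_graph Y, forall h, loop_value X h -> loop_value Y h,
         #|edge Y|.+1 = #|edge X| & #|vert Y|.+1 = #|vert X|]) \/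
  (exists Y : marked_graph L F,
     [/\ developed e idfun Y, connected_graph Y,
         forall h, loop_value X h -> loop_value Y (f h),
         #|edge Y|.+1 = #|edge X| & #|vert Y| = #|vert X|]).
Proof.
move=> devX connX; have [g dev_g] := devX.
have [t_eq|] := eqVneq (dtgt d) (dtgt d').
  case: d d' t_eq => [x b] [x' b'] t_eq dd' s_eq [l_eq b_eq]; subst b'.
  have xx' : x != x' by apply: contraNneq dd' => ->.
  have [src_eq tgt_eq] : src x' = src x /\ tgt x' = tgt x.
    by move: t_eq s_eq; rewrite /dtgt /dsrc /=; case: b {dd'} => /= -> ->.
  right; exists (@delete_edge _ _ (push_marks f X) x'); split.
  - exact/delete_developed/push_developed.
  - apply: (@delete_connected _ _ (push_marks f X) x' x) => //.
  - move=> h /(push_loop f); apply: (@delete_loop _ _ (push_marks f X) x' x) => //=.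
    by case: dev_g => _ gE; rewrite !gE src_eq tgt_eq l_eq.
  - exact: card_delete.
  - by [].
(* The vertex that disappears must not be the base, so that the gauge is trivial
   there. *)
wlog t'_base : d d' / base X != dtgt d'.
  move=> thm tt' dd' s_eq l_eq; have [t'_base|] := eqVneq (base X) (dtgt d'); last first.
    by move=> nb; apply: (thm d d' nb).
  have td'd: dtgt d' != dtgt d by rewrite eq_sym.
  by apply: (thm d' d _ td'd); rewrite ?t'_base // eq_sym.
case: d d' t'_base => [x b] [x' b'] t'_base tt' dd' s_eq [l_eq b_eq]; subst b'.
have xx' : x != x' by apply: contraNneq dd' => ->.
pose m := letter_value (@mark _ _ X); pose a := (m (x, b))^-1 * m (x', b).
have aE : f a = g (dtgt (x, b)) * (g (dtgt (x', b)))^-1.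
  rewrite gmulfM multV !(dart_developed _ dev_g) s_eq {1}/dlab /= l_eq.
  by rewrite !invgM invgK !mulgA mulgVK mulgVK.
pose Y := merge_vertices a tt'.
have [[src_eq tgt_eq] mark_eq] :
    (src (x' : edge Y) = src (x : edge Y) /\ tgt (x' : edge Y) = tgt (x : edge Y)) /\
    mark (x' : edge Y) = mark (x : edge Y).
  have mergeE : collapse tt' (dtgt (x', b)) = collapse tt' (dtgt (x, b)).
    by apply: val_inj; rewrite !val_collapse eqxx (negbTE tt').
  move: @a aE @Y mergeE; rewrite /collapse_gauge /m; move: t'_base tt' s_eq.
  rewrite /dtgt /dsrc /letter_value; case: b {dd' m} => /= t'_base tt' s_eq aE mergeE.
    rewrite /collapse_gauge s_eq mergeE (negbTE tt') eqxx invg1 mulg1.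
    by rewrite invgM invgK !mulgA mulgK.
  rewrite /collapse_gauge s_eq mergeE (negbTE tt') eqxx mul1g.
  by rewrite invgK mulgVK.
left; exists (@delete_edge _ _ Y x'); split.
- exact/delete_developed/(merge_developed _ _ dev_g).
- by apply: (@delete_connected _ _ Y x' x) => //; apply: merge_connected.
- by move=> h loop_h; apply: (@delete_loop _ _ Y x' x) => //; apply: merge_loop.
- by rewrite (@card_delete _ _ Y).
- exact: card_merge.
Qed.

(** Fold until the graph is folded. In a folded graph with its markings in H
    intact, a closed walk whose mark lies in the kernel of f spells a reduced
    word with trivial value, hence is trivial: f is injective on the marks. The
    induction covers all groups H because a fold that loses the markings restarts
    with H = F. *)
Lemma fold_graph (H : groupType) (f : {multiplicative H -> F})
    (X : marked_graph L H) :
  (forall s, reduced s -> word_value e s = 1 -> s = [::]) ->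
  developed e f X -> connected_graph X ->
  exists Y : marked_graph L F,
    [/\ developed e idfun Y, connected_graph Y, folded_graph Y &
        forall h, loop_value X h -> loop_value Y (f h)] /\
    (#|edge Y| + #|vert X| < #|vert Y| + #|edge X| \/
     #|edge Y| + #|vert X| = #|vert Y| + #|edge X| /\
     forall h, loop_value X h -> f h = 1 -> h = 1).
Proof.
move=> free_e; have [n] := ubnP #|edge X|.
elim: n => // n IHn in H f X *; rewrite ltnS => leXn devX connX.
have [foldX|] := boolP [forall d, forall d' : letter (edge X),
   (dsrc d == dsrc d') && (dlab d == dlab d') ==> (d == d')].
  have {}foldX : folded_graph X.
    move=> d d' s_eq l_eq; apply/eqP; move/forallP/(_ d)/forallP/(_ d'): foldX.
    by rewrite s_eq l_eq !eqxx.
  exists (push_marks f X); split.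
    split; [exact: push_developed | exact: push_connected | exact: foldX |].
    exact: push_loop.
  right; split=> [|h [ds /walk_reduce walk_ds <-]]; first by rewrite addnC.
  move: (word_value_mul (@mark _ _ X) ds [::]); rewrite /= mulg1 => <-.
  rewrite (developed_loop devX walk_ds) => /free_e.
  have redds : reduced (mul_word ds [::]) by apply: mul_word_reduced.
  by move/(_ (folded_reduced foldX walk_ds redds)); case: mul_word.
rewrite negb_forall => /existsP[d]; rewrite negb_forall => /existsP[d'].
rewrite negb_imply => /andP[/andP[/eqP s_eq /eqP l_eq] dd'].
have [] := fold_step devX connX dd' s_eq l_eq => -[Y [devY connY loopY cardE cardV]].
  have [|Z [[devZ connZ foldZ loopZ] cardZ]] := IHn _ f Y _ devY connY; first lia.
  exists Z; split; first by split=> // h /loopY/loopZ.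
  case: cardZ => [cardZ|[cardZ injY]]; [left; lia | right; split; first lia].
  by move=> h /loopY; apply: injY.
have [|Z [[devZ connZ foldZ loopZ] cardZ]] := IHn _ idfun Y _ devY connY; first lia.
exists Z; split; first by split=> // h /loopY/loopZ.
by left; case: cardZ => [|[]]; lia.
Qed.

Section Petals.
Variables (H : groupType) (f : {multiplicative H -> F}).

Section AddEdge.
Variables (X : marked_graph L H) (u : vert X) (l : letter L).

Definition add_edge :=
  @MarkedGraph L H (option (vert X)) (option (edge X))
    (fun x => if x is Some y then Some (src y) else if l.2 then Some u else None)
    (fun x => if x is Some y then Some (tgt y) else if l.2 then None else Some u)
    (fun x => if x is Some y then lab y else l.1)
    (fun x => if x is Some y then mark y else 1)
    (Some (base X)).

Lemma add_edge_developed g : developed_by e f g ->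
  @developed_by _ _ e _ f add_edge
     (fun v => if v is Some w then g w else g u * letter_value e l).
Proof.
case=> g1 gE; split=> // -[x|] /=; first exact: gE.
rewrite mult1 /letter_value; case: l.2; first by rewrite mulgV.
by rewrite mulgVK mulgV.
Qed.

Let add_mark (x : edge X) :
  mark (Some x : edge add_edge) = 1 * idfun (mark x) * 1^-1.
Proof. by rewrite invg1 mul1g mulg1. Qed.

Lemma add_edge_walk v ds w : @walk _ _ X v ds w ->
  exists2 ds', @walk _ _ add_edge (Some v) ds' (Some w) &
    word_value (@mark _ _ add_edge) ds' = word_value (@mark _ _ X) ds.
Proof.
move=> walk_ds; exists (map (fun d => (Some d.1, d.2)) ds).
  exact: (@morph_walk _ _ _ X add_edge Some Some).
rewrite (@morph_value _ _ _ idfun X add_edge Some (fun=> 1) _ _ _ _ walk_ds) //.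
by rewrite invg1 mul1g mulg1.
Qed.

Lemma add_edge_new : @walk _ _ add_edge (Some u) [:: (None, l.2)] None.
Proof. by rewrite /= /dtgt /dsrc /=; case: l.2 => /=; rewrite !eqxx. Qed.

Lemma add_edge_connected : connected_graph X -> connected_graph add_edge.
Proof.
move=> connX; have conn_some w : exists ds, @walk _ _ add_edge (base add_edge) ds (Some w).
  by have [ds /add_edge_walk[ds']] := connX w; exists ds'.
case=> [w|] //; have [ds walk_ds] := conn_some u.
by exists (ds ++ [:: (None, l.2)]); apply: walk_cat walk_ds add_edge_new.
Qed.

End AddEdge.

(** The disjunction ensures that the end of the tail is not the base vertex, so
    that the end can later be merged into the base. *)
Lemma add_tail (X : marked_graph L H) g u ds s :
  developed_by e f g -> connected_graph X -> walk (base X) ds u ->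
  word_value (@mark _ _ X) ds = 1 -> (u != base X) || (s != [::]) ->
  exists (Y : marked_graph L H) (g' : vert Y -> F) (v : vert Y),
    [/\ developed_by e f g', connected_graph Y, 
       forall h, loop_value X h -> loop_value Y h,
       #|edge Y| + #|vert X| = #|vert Y| + #|edge X| &
       [/\ v != base Y, g' v = g u * word_value e s & 
          exists2 ds', walk (base Y) ds' v & word_value (@mark _ _ Y) ds' = 1]].
Proof.
elim: s X g u ds => [|l s IHs] X g u ds dev_g connX walk_ds ds1.
  rewrite orbF => u_base; exists X, g, u; split=> //; first by rewrite addnC.
  by split=> //; [rewrite mulg1 | exists ds].
move=> _; have dev_g' := add_edge_developed u l dev_g.
have [ds' walk_ds' ds'1] := add_edge_walk u l walk_ds.
have walk_new := walk_cat walk_ds' (add_edge_new u l).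
have [||Y [g' [v [dev_Y connY loopY cardY [vY gv walkY]]]]] :=
    IHs _ _ _ _ dev_g' (add_edge_connected connX) walk_new.
- by rewrite word_value_cat ds'1 ds1 mul1g /= /letter_value; case: l.2; rewrite /= ?invg1 mulg1.
- by [].
exists Y, g', v; split=> //.
- by move=> h [cs /(add_edge_walk u l)[cs' walk_cs' <-] <-]; apply: loopY; exists cs'.
- by move: cardY; rewrite /= !card_option !addnS => -[].
- by split=> //; rewrite gv /= mulgA.
Qed.

(** The end of a tail spelling s is merged into the base with a gauge that gives
    the new loop the mark h. *)
Lemma add_petal (X : marked_graph L H) h s :
  developed e f X -> connected_graph X -> f h = word_value e s -> s != [::] ->
  exists Y : marked_graph L H,
    [/\ developed e f Y, connected_graph Y, loop_value Y h,
       forall a, loop_value X a -> loop_value Y a &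
       #|edge Y| + #|vert X| = (#|vert Y| + #|edge X|).+1].
Proof.
case=> g dev_g connX fh s0.
have [||Y [g' [v [dev_Y connY loopY cardY [vY gv [ds walk_ds ds1]]]]]] :=
    @add_tail X g (base X) [::] s dev_g connX (eqxx _).
- by [].
- by rewrite s0 orbT.
have v_base : base Y != v by rewrite eq_sym.
exists (merge_vertices h^-1 v_base); split.
- by apply: (merge_developed _ _ dev_Y) => //; rewrite multV fh gv dev_g.1 dev_Y.1 !mul1g.
- exact: merge_connected.
- have := merge_closes h^-1 v_base v_base (erefl _) walk_ds.
  by rewrite ds1 invgK mul1g.
- by move=> a /loopY; apply: merge_loop.
- by rewrite -addSn (card_merge h^-1 v_base).
Qed.

Definition point_graph :=
  @MarkedGraph L H unit void (of_void _) (of_void _) (of_void _) (of_void _) tt.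

Lemma point_developed : developed e f point_graph.
Proof. by exists (fun=> 1); split=> // -[]. Qed.

Lemma point_connected : connected_graph point_graph.
Proof. by case; exists [::]. Qed.

Lemma petal_graph n (h : 'I_n -> H) :
  (forall g, exists2 s, s != [::] & g = word_value e s) ->
  exists X : marked_graph L H,
    [/\ developed e f X, connected_graph X, forall i, loop_value X (h i) &
       #|edge X|.+1 = #|vert X| + n].
Proof.
move=> surj_e; elim: n h => [|n IHn] h.
  exists point_graph; split; [exact: point_developed | exact: point_connected | by case |].
  by rewrite card_unit card_void.
have [X [devX connX loopX cardX]] := IHn (h \o lift ord0).
have [s s0 fh] := surj_e (f (h ord0)).
have [Y [devY connY loop0 loopY cardY]] := add_petal devX connX fh s0.
exists Y; split=> // [i|]; last by lia.
by case: (unliftP ord0 i) => [j ->|->] //; apply/loopY/loopX.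
Qed.

End Petals.
End Folding.

Section CoreGraph.
Variables (L : choiceType) (F : groupType) (e : L -> F) (l0 : L).
Hypothesis free_e : free_basis e.

(** The result of folding n petals, where |E| + 1 = |V| + n. The number |E| - |V|
    is preserved only if all folds are homotopy equivalences, and then no
    relation among the marks has been imposed. *)
Theorem stallings_graph n (H : groupType) (b : 'I_n -> H)
    (f : {multiplicative H -> F}) :
  free_basis b ->
  exists X : marked_graph L F,
    [/\ connected_graph X, folded_graph X &
        forall h, exists2 ds, walk (base X) ds (base X) &
          word_value e (map (@dlab _ _ X) ds) = f h] /\
    (#|edge X|.+1 < #|vert X| + n \/
     #|edge X|.+1 = #|vert X| + n /\ injective f).
Proof.
move=> free_b.
have surj_e g : exists2 s, s != [::] & g = word_value e s.
  have [s reds ->] := free_basis_surj free_e g.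
(* A petal needs at least one edge, also when g is trivial. *)
  exists ((l0, true) :: (l0, false) :: s) => //=.
  by rewrite /letter_value /= mulVKg.
have inj_e s : reduced s -> word_value e s = 1 -> s = [::].
  by move=> reds; apply: (free_basis_inj free_e (t := [::])).
have [X [devX connX loop_b cardX]] := petal_graph f b surj_e.
have loopX h : loop_value X h.
  by have [s _ ->] := free_basis_surj free_b h; apply: loop_value_word.
have [Y [[devY connY foldY loopY] cardY]] := fold_graph inj_e devX connX.
exists Y; split.
  split=> // h; have [ds walk_ds dsE] := loopY h (loopX h); exists ds => //.
  by rewrite -(developed_loop devY walk_ds).
case: cardY => [cardY|[cardY injf]]; first by left; lia.
right; split; first by lia.
by apply: mult_inj => h; apply: injf.
Qed.

End CoreGraph.

(** * Branching of the intersection graph *)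

Lemma inv_word_rcons (X : Type) (s : seq (letter X)) l :
  inv_word (rcons s l) = flip l :: inv_word s.
Proof. by rewrite /inv_word map_rcons rev_rcons. Qed.

Lemma inv_word_cons (X : Type) (s : seq (letter X)) l :
  inv_word (l :: s) = rcons (inv_word s) (flip l).
Proof. by rewrite /inv_word /= rev_cons. Qed.

Lemma size_inv_word (X : Type) (s : seq (letter X)) : size (inv_word s) = size s.
Proof. by rewrite size_rev size_map. Qed.

Lemma reduced_catr (X : eqType) (s t : seq (letter X)) : reduced (s ++ t) -> reduced t.
Proof. by elim: s => //= l s IHs /reduced_behead. Qed.

Lemma reduced_catl (X : eqType) (s t : seq (letter X)) : reduced (s ++ t) -> reduced s.
Proof. by case: s => //= l s; rewrite /reduced /= cat_path => /andP[]. Qed.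

(** A reduced word equal to its inverse would have a letter equal to its own
    inverse in the middle, or two mutually inverse letters. *)
Lemma reduced_neq_inv (X : eqType) (s : seq (letter X)) :
  reduced s -> inv_word s = s -> s = [::].
Proof.
have [n] := ubnP (size s); elim: n s => // n IHn [//|l t] /= le_n reds.
case: (lastP t) le_n reds => [|m h] le_n reds; rewrite inv_word_cons.
  by case=> /eqP; rewrite flip_neq.
rewrite inv_word_rcons /= => -[hl]; move/rcons_inj => [inv_m hh].
have m0 : m = [::].
  apply: IHn => //; first by move: le_n; rewrite size_rcons; lia.
  by have := reduced_behead reds; rewrite -cats1 => /reduced_catl.
by move: reds; rewrite m0 /reduced /= -hh eqxx.
Qed.

Section Branching.
Variables (L T : finType) (next : T -> letter L -> option T).
Hypothesis next_flip : forall u l w, next u l = Some w -> next w (flip l) = Some u.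

Fixpoint run (u : T) (s : seq (letter L)) : option T :=
  if s is l :: s' then if next u l is Some w then run w s' else None else Some u.

Lemma run_cat u s t : run u (s ++ t) = obind (run^~ t) (run u s).
Proof. by elim: s u => //= l s IHs u; case: next. Qed.

Lemma run_inv u s w : run u s = Some w -> run w (inv_word s) = Some u.
Proof.
elim: s u => [u [->]|l s IHs u] //=; case Eu: (next u l) => [v|] // /IHs run_w.
by rewrite inv_word_cons -cats1 run_cat run_w /= (next_flip Eu).
Qed.

Definition exits (C : {set T}) (v : T) : {set letter L} :=
  [set l | if next v l is Some w then w \in C else false].

Fixpoint stays (C : {set T}) (u : T) (s : seq (letter L)) : bool :=
  (u \in C) &&
  if s is l :: s' then if next u l is Some w then stays C w s' else false
  else true.

Lemma stays_in C u s : stays C u s -> u \in C.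
Proof. by case: s => [|l s] /= /andP[]. Qed.

Lemma stays_cat C u s t w : run u s = Some w ->
  stays C u (s ++ t) = stays C u s && stays C w t.
Proof.
elim: s u => [u [->]|l s IHs u] /=.
  by rewrite andbT; case: (boolP (stays C w t)) => [/stays_in->|]; rewrite ?andbF.
by case: next => // v /IHs->; rewrite andbA.
Qed.

Lemma stays_inv C u s w : run u s = Some w -> stays C u s -> stays C w (inv_word s).
Proof.
elim: s u => [u [->]|l s IHs u] //=; case Eu: (next u l) => [v|] // run_v /andP[uC stays_v].
rewrite inv_word_cons -cats1 (stays_cat _ _ (run_inv run_v)) (IHs _ run_v stays_v) /=.
by rewrite (stays_in stays_v) (next_flip Eu) uC.
Qed.

Lemma stays_exit C u l s : stays C u (l :: s) -> l \in exits C u.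
Proof. by rewrite inE /=; case: next => [w|] /andP[] // _ /stays_in. Qed.

Lemma stays_exit_last C u s l w : run u (rcons s l) = Some w ->
  stays C u (rcons s l) -> flip l \in exits C w.
Proof. by move=> run_w /(stays_inv run_w); rewrite inv_word_rcons => /stays_exit. Qed.

Fixpoint trace (u : T) (s : seq (letter L)) : seq T :=
  u :: if s is l :: s' then if next u l is Some w then trace w s' else [::] else [::].

Lemma trace_stays (C : {set T}) u s w : run u s = Some w ->
  {subset trace u s <= C} -> stays C u s.
Proof.
elim: s u => [|l s IHs] u /=; first by move=> _ -> //; rewrite mem_head.
case: next => // v run_v sub; rewrite sub ?mem_head //=.
by apply: IHs => // x xv; apply: sub; rewrite inE xv orbT.
Qed.

Lemma traceP u s v : v \in trace u s ->
  exists s1 s2, s = s1 ++ s2 /\ run u s1 = Some v.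
Proof.
elim: s u => [|l s IHs] u /=.
  by rewrite inE => /eqP->; exists [::], [::].
rewrite inE => /orP[/eqP->|]; first by exists [::], (l :: s).
case Eu: (next u l) => [w|] // /IHs[s1 [s2 [-> run_v]]].
by exists (l :: s1), s2; rewrite /= Eu.
Qed.

(** An inner vertex of a reduced path is left both by the next letter and by the
    inverse of the previous one. *)
Lemma interior_degree C u s1 s2 v : run u s1 = Some v -> reduced (s1 ++ s2) ->
  stays C u (s1 ++ s2) -> s1 != [::] -> s2 != [::] -> 1 < #|exits C v|.
Proof.
move=> run_v red; rewrite (stays_cat _ _ run_v) => /andP[].
case: (lastP s1) run_v red => // s l run_v red stay_s.
case: s2 red => // h t red /stays_exit h_exit _ _.
have l_exit := stays_exit_last run_v stay_s.
rewrite -cats1 -catA /= in red; have /= := reduced_catr red.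
rewrite /reduced /= => /andP[h_neq _].
rewrite (cardD1 h) h_exit /= ltnS; apply/card_gt0P; exists (flip l).
by rewrite !inE eq_sym h_neq; move: l_exit; rewrite inE.
Qed.

Lemma three_exits C v l1 l2 l3 : #|exits C v| <= 2 ->
  l1 \in exits C v -> l2 \in exits C v -> l3 \in exits C v ->
  l1 != l2 -> l1 != l3 -> l2 = l3.
Proof.
move=> le2 l1v l2v l3v l12 l13; apply/eqP; apply: contraTT le2 => l23.
rewrite -ltnNge (cardD1 l1) l1v (cardD1 l2) (cardD1 l3) !inE.
rewrite eq_sym l12 [l3 == l1]eq_sym l13 [l3 == l2]eq_sym l23.
by move: l2v l3v; rewrite !inE => -> ->.
Qed.

(** With only two exits everywhere, a reduced path is determined by its first
    step and its length. *)
Lemma stays_prefix (C : {set T}) u p s t :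
  {in C, forall v, #|exits C v| <= 2} -> p \in exits C u ->
  stays C u s -> stays C u t ->
  reduced (flip p :: s) -> reduced (flip p :: t) -> 
  exists r, t = s ++ r \/ s = t ++ r.
Proof.
move=> le2; elim: s u p t => [|l s IHs] u p [|h t] p_exit; try by eexists; left.
  by eexists; right.
move=> stay_l stay_h red_l red_h.
have lh : l = h.
  apply: (@three_exits C u p); rewrite ?le2 ?(stays_in stay_l) //;
    rewrite ?(stays_exit stay_l) ?(stays_exit stay_h) //.
    by move: red_l; rewrite /reduced /= flipK eq_sym => /andP[].
  by move: red_h; rewrite /reduced /= flipK eq_sym => /andP[].
subst h; move: stay_l stay_h => /=; case Eu: (next u l) => [w|]; last by rewrite andbF.
move=> /andP[uC stay_s] /andP[_ stay_t].
have [|||r rE] := IHs w (flip l) t _ stay_s stay_t.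
- by rewrite inE (next_flip Eu).
- by rewrite flipK; apply: reduced_behead red_l.
- by rewrite flipK; apply: reduced_behead red_h.
by exists r; case: rE => ->; [left | right].
Qed.

Lemma common_prefix (C : {set T}) u s t l :
  {in C, forall v, #|exits C v| <= 2} ->
  reduced s -> reduced t -> stays C u s -> stays C u t ->
  ohead s = Some l -> ohead t = Some l -> exists r, t = s ++ r \/ s = t ++ r.
Proof.
case: s t => [|l' s] [|l'' t] // le2 reds redt + + [eql] [eql']; subst l' l''.
rewrite /=; case Eu: (next u l) => [w|]; last by rewrite andbF.
move=> /andP[uC stay_s] /andP[_ stay_t].
have [|||r rE] := @stays_prefix C w (flip l) s t le2 _ stay_s stay_t.
- by rewrite inE (next_flip Eu).
- by rewrite flipK.
- by rewrite flipK.
by exists r; case: rE => ->; [left | right].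
Qed.

Lemma peel_loop u s l : reduced s -> run u s = Some u ->
  ohead s = Some l -> ohead (inv_word s) = Some l ->
  exists w s', [/\ next u l = Some w, s = l :: rcons s' (flip l) & run w s' = Some w].
Proof.
case: s => // h t reds + [hl]; subst h.
case: (lastP t) reds => [|s' h] reds /=.
  by move=> _ [] /eqP; rewrite flip_neq.
rewrite inv_word_cons inv_word_rcons /= => + [hl].
have {}hl : h = flip l by rewrite -hl flipK.
subst h; case Eu: (next u l) => [w|] //; rewrite -cats1 run_cat => run_s.
exists w, s'; split=> //; first by rewrite cats1.
case: (run w s') run_s => //= x; case Ex: (next x (flip l)) => [y|] // [yu]; subst y.
by have := next_flip Ex; rewrite flipK Eu => -[->].
Qed.

Variables (F : groupType) (e : L -> F).

Lemma conj_noncommute (l a b : F) :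
  ~ commute (l * a * l^-1) (l * b * l^-1) -> ~ commute a b.
Proof.
move=> nab ab; apply: nab; rewrite /commute !mulgA !mulgVK -!mulgA.
by congr (_ * _); rewrite !mulgA ab.
Qed.

(** Induction on the total length of the two loops; C consists of the vertices
    that they visit. If all four ends of the loops at u use the same letter,
    conjugation by it shortens both loops. Otherwise every vertex of C has two
    exits, and it remains to find a vertex with three. If there is none, reduced
    paths in C are determined by their first letter and length. So if one of a
    and its inverse starts like one of b and its inverse, then one of these is a
    prefix of the other and can be cancelled, which shortens the pair. If not,
    then a and its inverse start with the same letter, as u has only two exits,
    and so they coincide, which is impossible. *)
Lemma branching_set u a b : reduced a -> reduced b ->
  run u a = Some u -> run u b = Some u ->
  ~ commute (word_value e a) (word_value e b) ->
  exists C : {set T}, {in C, forall v, 1 < #|exits C v|} /\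
                      exists2 v, v \in C & 2 < #|exits C v|.
Proof.
have [n] := ubnP (size a + size b); elim: n u a b => // n IHn u a b.
rewrite ltnS => le_n reda redb runa runb nab.
have a0 : a != [::] by apply: contra_notN nab => /eqP->; apply/commute_sym/commute1.
have b0 : b != [::] by apply: contra_notN nab => /eqP->; apply/commute1.
pose C : {set T} := [set v in trace u a ++ trace u b].
have stay_a : stays C u a.
  by apply: trace_stays runa _ => v va; rewrite inE mem_cat va.
have stay_b : stays C u b.
  by apply: trace_stays runb _ => v vb; rewrite inE mem_cat vb orbT.
have stay_ia := stays_inv runa stay_a; have stay_ib := stays_inv runb stay_b.
have uC := stays_in stay_a.
(* Of two loops with a common first letter, one is a prefix of the other;
   cancelling it leaves a shorter pair. *)
have shorten A B l : {in C, forall v, #|exits C v| <= 2} ->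
    reduced A -> reduced B -> run u A = Some u -> run u B = Some u ->
    stays C u A -> stays C u B -> size A + size B <= n ->
    ~ commute (word_value e A) (word_value e B) ->
    ohead A = Some l -> ohead B = Some l ->
    exists C : {set T}, {in C, forall v, 1 < #|exits C v|} /\
                      exists2 v, v \in C & 2 < #|exits C v|.
  move=> le2 redA redB runA runB stayA stayB leAB nAB hdA hdB.
  have A_gt0 : 0 < size A by case: (A) hdA.
  have B_gt0 : 0 < size B by case: (B) hdB.
  have [r [rE|rE]] := common_prefix le2 redA redB stayA stayB hdA hdB; subst.
    move: runB; rewrite run_cat runA /= => runr.
    apply: (IHn u A r _ redA (reduced_catr redB) runA runr).
      by clear -leAB A_gt0; move: leAB; rewrite size_cat; lia.
    by move=> Ar; apply: nAB; rewrite word_value_cat; apply: commuteM.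
  move: runA; rewrite run_cat runB /= => runr.
  apply: (IHn u B r _ redB (reduced_catr redA) runB runr).
    by clear -leAB B_gt0; move: leAB; rewrite size_cat; lia.
  move=> Br; apply: nAB; rewrite word_value_cat; apply/commute_sym.
  exact: commuteM.
have heads s : s != [::] -> stays C u s -> run u s = Some u ->
    exists l h, [/\ ohead s = Some l, ohead (inv_word s) = Some (flip h) &
      l \in exits C u /\ flip h \in exits C u].
  case: s => // l s _; case: (lastP s) => [|t h] stay_s run_s.
    exists l, l; split=> //; split; first exact: stays_exit stay_s.
    exact: (@stays_exit_last C u [::]) run_s stay_s.
  exists l, h; split=> //; last split; last 1 first.
  - by rewrite -rcons_cons in stay_s run_s; apply: stays_exit_last run_s stay_s.
  - by rewrite inv_word_cons inv_word_rcons.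
  exact: stays_exit stay_s.
have [la [ha [hdA hdIA [la_exit ha_exit]]]] := heads a a0 stay_a runa.
have [lb [hb [hdB hdIB [lb_exit hb_exit]]]] := heads b b0 stay_b runb.
have [/andP[/andP[/eqP haE /eqP lbE] /eqP hbE]|neq] :=
    boolP ((flip ha == la) && (lb == la) && (flip hb == la)).
  rewrite haE in hdIA; rewrite hbE in hdIB; rewrite lbE in hdB.
  have [w [a' [Eu aE run_a']]] := peel_loop reda runa hdA hdIA.
  have [w' [b' [Eu' bE run_b']]] := peel_loop redb runb hdB hdIB.
  move: Eu'; rewrite Eu => -[ww']; subst w' a b.
  apply: (IHn w a' b') => //.
  - by clear -le_n; move: le_n; rewrite /= !size_rcons; lia.
  - by have := reduced_behead reda; rewrite -cats1; apply: reduced_catl.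
  - by have := reduced_behead redb; rewrite -cats1; apply: reduced_catl.
  apply: (@conj_noncommute (letter_value e la)).
  have valE s : word_value e (la :: rcons s (flip la)) =
      letter_value e la * word_value e s * (letter_value e la)^-1.
    by rewrite /= -cats1 word_value_cat /= mulg1 letter_value_flip mulgA.
  by rewrite -!valE.
have two_exits v : v \in C -> 1 < #|exits C v|.
  have u_two : 1 < #|exits C u|.
    apply: contraR neq; rewrite -leqNgt => /card_le1_eqP eq1.
    by rewrite (eq1 _ _ la_exit ha_exit) (eq1 _ _ la_exit hb_exit)
      (eq1 _ _ la_exit lb_exit) !eqxx.
  have split_two s : reduced s -> stays C u s -> run u s = Some u ->
      v \in trace u s -> 1 < #|exits C v|.
    move=> reds stay_s run_s /traceP[s1 [s2 [sE run_v]]]; subst s.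
    have [s10|s10] := eqVneq s1 [::]; first by move: run_v; rewrite s10 => -[<-].
    have [s20|s20] := eqVneq s2 [::]; last exact: interior_degree run_v reds stay_s s10 s20.
    by move: run_s; rewrite s20 cats0 run_v => -[->].
  by rewrite inE mem_cat => /orP[]; apply: split_two.
have [/exists_inP[v vC v3]|] := boolP [exists v in C, 2 < #|exits C v|].
  by exists C; split=> //; exists v.
rewrite negb_exists_in => /forall_inP le2.
have {}le2 : {in C, forall v, #|exits C v| <= 2}.
  by move=> v /le2; rewrite -leqNgt.
have [eq_ab|neq_ab] := eqVneq la lb.
  by apply: (shorten a b la) => //; rewrite eq_ab.
have [eq_aib|neq_aib] := eqVneq la (flip hb).
  apply: (shorten a (inv_word b) la) => //.
  - by rewrite reduced_inv.
  - exact: run_inv.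
  - by rewrite size_inv_word.
  - by rewrite word_value_inv => ab; apply: nab; rewrite -[word_value e b]invgK; apply: commuteV.
  - by rewrite eq_aib.
have [eq_iab|neq_iab] := eqVneq (flip ha) lb.
  apply: (shorten (inv_word a) b lb) => //.
  - by rewrite reduced_inv.
  - exact: run_inv.
  - by rewrite size_inv_word.
  - rewrite word_value_inv => /commute_sym ab; apply: nab; apply/commute_sym.
    by rewrite -[word_value e a]invgK; apply: commuteV.
  - by rewrite -eq_iab.
have eq_a : la = flip ha.
  by apply: (three_exits (le2 u uC) lb_exit) => //; rewrite eq_sym.
have redia : reduced (inv_word a) by rewrite reduced_inv.
rewrite -eq_a in hdIA.
have [r rE] := common_prefix le2 reda redia stay_a stay_ia hdA hdIA.
have r0 : r = [::].
  apply: size0nil; clear -rE; have := size_inv_word a.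
  by case: rE => /(congr1 size); rewrite size_cat; lia.
case/eqP: a0; apply: reduced_neq_inv => //.
by case: rE; rewrite r0 cats0.
Qed.
End Branching.

(** * Linear algebra of families of vectors *)

Local Close Scope group_scope.
Local Open Scope ring_scope.

Section Families.
Variables (K : fieldType) (vT : vectType K) (I : eqType) (phi : I -> vT).

Lemma sum_mem_span (s : seq I) (k : I -> K) :
  \sum_(i <- s) k i *: phi i \in <<map phi s>>%VS.
Proof.
rewrite big_seq; apply: memv_suml => i si.
by apply/memvZ/memv_span/map_f.
Qed.

Lemma span_map_sum (s : seq I) v : uniq s -> v \in <<map phi s>>%VS ->
  exists k : I -> K, v = \sum_(i <- s) k i *: phi i.
Proof.
elim: s v => [|i s IHs] v /=.
  by rewrite span_nil memv0 => _ /eqP->; exists (fun=> 0); rewrite big_nil.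
case/andP=> si uniq_s; rewrite span_cons => /memv_addP[_ /vlineP[c ->] [w ws ->]].
have [k ->] := IHs _ uniq_s ws.
exists (fun j => if j == i then c else k j); rewrite big_cons eqxx.
congr (_ + _); apply: eq_big_seq => j sj.
by case: eqP sj si => // -> ->.
Qed.

Lemma free_mapP (s : seq I) : uniq s ->
  (forall k : I -> K, \sum_(i <- s) k i *: phi i = 0 -> {in s, forall i, k i = 0}) <->
  free (map phi s).
Proof.
move=> uniq_s; split.
  elim: s uniq_s => [|i s IHs] /=; first by rewrite nil_free.
  case/andP=> si uniq_s indep; rewrite free_cons; apply/andP; split.
    apply/negP => /(span_map_sum uniq_s)[k kE].
    have := indep (fun j => if j == i then - 1 else k j).
    rewrite big_cons eqxx scaleN1r (eq_big_seq (fun j => k j *: phi j)).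
      rewrite -kE addNr => /(_ erefl i (mem_head _ _)) /eqP.
      by rewrite eqxx oppr_eq0 oner_eq0.
    by move=> j sj; case: eqP sj si => // -> ->.
  apply: IHs => // k k0 j sj.
  have := indep (fun l => if l == i then 0 else k l).
  rewrite big_cons eqxx scale0r add0r (eq_big_seq (fun j => k j *: phi j)).
    move=> /(_ k0 j); rewrite inE sj orbT => /(_ isT).
    by case: eqP sj si => // -> ->.
  by move=> l sl; case: eqP sl si => // -> ->.
elim: s uniq_s => [|i s IHs] //= /andP[si uniq_s].
rewrite free_cons => /andP[phi_i free_s] k; rewrite big_cons => k0.
have ki : k i = 0.
  apply/eqP; apply: contraNT phi_i => ki.
  have -> : phi i = - (k i)^-1 *: \sum_(j <- s) k j *: phi j.
    move/eqP: k0; rewrite addr_eq0 => /eqP kE.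
    by rewrite scaleNr -scalerN -kE scalerA mulVf // scale1r.
  exact/memvZ/sum_mem_span.
move: k0; rewrite ki scale0r add0r => /(IHs uniq_s free_s) k0 j.
by rewrite inE => /orP[/eqP->|/k0].
Qed.

Lemma free_map_sub (s t : seq I) :
  free (map phi s) -> uniq t -> {subset t <= s} -> free (map phi t).
Proof.
move=> free_s uniq_t sub.
have uniq_s : uniq s by apply: map_uniq (free_uniq free_s).
have perm_t : perm_eq t (filter (mem t) s).
  apply: uniq_perm; rewrite ?filter_uniq // => i.
  by rewrite mem_filter /=; case: (boolP (i \in t)) => // /sub->.
rewrite (perm_free (perm_map phi perm_t)).
apply: (@catl_free _ _ (map phi (filter (predC (mem t)) s))).
by rewrite -map_cat (perm_free (perm_map phi (permEl (perm_filterC _ _)))).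
Qed.

(** Extension of a free subfamily to a basis of the span of a family. It is
    stated for families of indices because the proof that a branching subgraph
    yields more edge than vertex relations needs the indices of the basis. *)
Lemma extend_free (s b : seq I) : free (map phi b) ->
  exists b' : seq I, [/\ {subset b <= b'}, {subset b' <= b ++ s}, free (map phi b') &
    {in s, forall i, phi i \in <<map phi b'>>%VS}].
Proof.
elim: s b => [|i s IHs] b free_b.
  by exists b; split=> // j; rewrite cats0.
have [phi_i|phi_i] := boolP (phi i \in <<map phi b>>%VS).
  have [b' [bb' b's free_b' sb']] := IHs b free_b.
  exists b'; split=> // j; first by move/b's; rewrite !mem_cat inE orbCA orbC => ->; rewrite ?orbT.
  rewrite inE => /orP[/eqP->|/sb'//].
  by move: phi_i; apply/subvP/sub_span => v /mapP[l /bb' lb ->]; apply: map_f.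
have [|b' [bb' b's free_b' sb']] := IHs (i :: b).
  by rewrite /= free_cons phi_i.
exists b'; split=> // [j bj|j /b's|j].
- by apply: bb'; rewrite inE bj orbT.
- by rewrite !mem_cat !inE orbCA orbA.
rewrite inE => /orP[/eqP->|/sb'//].
by apply/memv_span/map_f/bb'/mem_head.
Qed.

End Families.

Section FreeVector.
Variable K : fieldType.

Definition unit_vec (T : finType) (t : T) : 'rV[K]_#|T| := delta_mx 0 (enum_rank t).

Definition extend (T : finType) (vT : vectType K) (h : T -> vT) : 'Hom('rV[K]_#|T|, vT) :=
  linfun (fun u : 'rV[K]_#|T| => \sum_j u 0 j *: h (enum_val j)).

Lemma extendE (T : finType) (vT : vectType K) (h : T -> vT) t :
  extend h (unit_vec t) = h t.
Proof.
have lin : linear (fun u : 'rV[K]_#|T| => \sum_j u 0 j *: h (enum_val j)).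
  move=> c u v; rewrite scaler_sumr -big_split /=; apply: eq_bigr => j _.
  by rewrite !mxE scalerDl scalerA.
pose f := GRing.isLinear.Build _ _ _ _ _ lin.
pose g : {linear 'rV[K]_#|T| -> vT} :=
  HB.pack (fun u : 'rV[K]_#|T| => \sum_j u 0 j *: h (enum_val j)) f.
rewrite /extend (lfunE g) /= (bigD1 (enum_rank t)) //= big1 => [|j jt].
  by rewrite mxE !eqxx scale1r enum_rankK addr0.
by rewrite mxE (negbTE jt) andbF scale0r.
Qed.

Lemma unit_vec_span (T : finType) : (fullv <= <<map (@unit_vec T) (enum T)>>)%VS.
Proof.
apply/subvP => u _; rewrite (row_sum_delta u); apply: memv_suml => j _.
apply/memvZ/memv_span/mapP; exists (enum_val j); first exact: mem_enum.
by rewrite /unit_vec enum_valK.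
Qed.

End FreeVector.

(** * Homology of two graphs glued along a common part *)

Lemma walk_potential (L : Type) (H : groupType) (X : marked_graph L H) (K : groupType)
    (c : vert X -> K) (h : L -> K) u ds v :
  (forall x : edge X, c (src x) * h (lab x) = c (tgt x))%g -> walk u ds v ->
  (c u * word_value h (map (@dlab _ _ X) ds) = c v)%g.
Proof.
move=> cE; elim: ds u => [|d ds IHds] u /=; first by move/eqP->; rewrite mulg1.
case/andP=> /eqP<- /IHds <-; rewrite mulgA; congr (_ * _)%g.
case: d => x [] /=; rewrite /letter_value /dtgt /dsrc /= -cE //.
by rewrite mulgK.
Qed.

Definition kills_loops (L : Type) (H : groupType) (X : marked_graph L H)
    (K : groupType) (h : L -> K) :=
  forall ds, walk (base X) ds (base X) ->
  word_value h (map (@dlab _ _ X) ds) = 1%g.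

Lemma lker_exists (K : fieldType) (vT : vectType K) (U : {vspace vT}) :
  exists P : 'End(vT), lker P = U.
Proof.
exists (\1 - projv U)%VF; apply/vspaceP => u; rewrite memv_ker !lfunE /= lfunE /= lfunE /=.
rewrite subr_eq0; apply/eqP/idP => [->|uU]; first exact: memv_proj.
by rewrite projv_id.
Qed.

(** In the cellular chains modulo 2 of the disjoint union of X1 and X2, each
    vertex of C identifies two vertices, and each edge of the fibre product with
    both ends in C identifies two edges. The space of vertices is enlarged by one
    dimension for each letter, and the boundary of an edge by its letter, so that
    the boundary also computes the image of a cycle in the abelianised target. *)
Section RankBound.
Variables (L : finType) (H : groupType) (X1 X2 : marked_graph L H).
Variable C : {set vert X1 * vert X2}.

Let V : finType := (vert X1 + vert X2)%type.
Let E : finType := (edge X1 + edge X2)%type.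
Let T : finType := (V + L)%type.

Let esrc (x : E) : V := match x with inl y => inl (src y) | inr y => inr (src y) end.
Let etgt (x : E) : V := match x with inl y => inl (tgt y) | inr y => inr (tgt y) end.
Let elab (x : E) : L := match x with inl y => lab y | inr y => lab y end.

Definition vert_vec (v : V) : 'rV['F_2]_#|T| := unit_vec _ (inl v).
Definition lab_vec (l : L) : 'rV['F_2]_#|T| := unit_vec _ (inr l).

Definition boundary : 'Hom('rV['F_2]_#|E|, 'rV['F_2]_#|T|) :=
  extend (fun x : E => vert_vec (esrc x) + lab_vec (elab x) - vert_vec (etgt x)).

Definition glue_vert (p : vert X1 * vert X2) : 'rV['F_2]_#|T| :=
  vert_vec (inl p.1) - vert_vec (inr p.2).

Definition glue_edge (p : edge X1 * edge X2) : 'rV['F_2]_#|E| :=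
  unit_vec _ (inl p.1) - unit_vec _ (inr p.2).

Definition edge_pairs : {set edge X1 * edge X2} :=
  [set p | [&& lab p.1 == lab p.2, (src p.1, src p.2) \in C & (tgt p.1, tgt p.2) \in C]].

Definition vert_relations : {vspace 'rV['F_2]_#|T|} := <<map glue_vert (enum C)>>.
Definition edge_relations : {vspace 'rV['F_2]_#|E|} := <<map glue_edge (enum edge_pairs)>>.

Lemma boundary_relations : (boundary @: edge_relations <= vert_relations)%VS.
Proof.
rewrite limg_span; apply/span_subvP => _ /mapP[_ /mapP[[x1 x2] + ->] ->].
rewrite mem_enum inE /= => /and3P[/eqP lab_eq srcC tgtC].
rewrite /glue_edge linearB /= /boundary !extendE /= lab_eq.
have -> : vert_vec (inl (src x1)) + lab_vec (lab x2) - vert_vec (inl (tgt x1)) -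
    (vert_vec (inr (src x2)) + lab_vec (lab x2) - vert_vec (inr (tgt x2))) =
    glue_vert (src x1, src x2) - glue_vert (tgt x1, tgt x2).
  by rewrite [_ + lab_vec _ - _]addrAC [_ + lab_vec _ - vert_vec (inr _)]addrAC
    [vert_vec (inr _) - _ + _]addrC addrKA !opprB addrACA [RHS]addrACA
    [- vert_vec _ - _]addrC.
by apply: rpredB; apply/memv_span/map_f; rewrite mem_enum.
Qed.

(** The boundary maps relations between edges to relations between vertices, so
    only a complement of the former contributes new dimensions. *)
Lemma dim_boundary_le :
  (\dim (limg boundary + vert_relations) + \dim edge_relations <=
   #|edge X1| + #|edge X2| + \dim vert_relations)%N.
Proof.
have dimE : (\dim edge_relations + \dim edge_relations^C = #|edge X1| + #|edge X2|)%N.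
  rewrite dimv_compl subnKC ?dimvS ?subvf // dimvf [LHS]dim_matrix mul1r.
  by rewrite card_sum.
have sub : (limg boundary + vert_relations <= boundary @: edge_relations^C + vert_relations)%VS.
  rewrite -{1}(addv_complf edge_relations) limgD !subv_add addvSr andbT addvSl andbT.
  exact: subv_trans boundary_relations (addvSr _ _).
rewrite -dimE addnC -addnA leq_add2l.
apply: leq_trans (dimvS sub) (leq_trans (dimv_add_leqif _ _).1 _).
by rewrite leq_add2r -(limg_ker_dim boundary (edge_relations^C)%VS) leq_addl.
Qed.

Section Branching.
Hypotheses (fold1 : folded_graph X1) (fold2 : folded_graph X2).

Definition next_vert (X : marked_graph L H) (v : vert X) (l : letter L) : option (vert X) :=
  omap (@dtgt _ _ X) [pick d : letter (edge X) | (dsrc d == v) && (dlab d == l)].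

Lemma next_vertP (X : marked_graph L H) (v : vert X) l w : next_vert v l = Some w ->
  exists d : letter (edge X), [/\ dsrc d = v, dlab d = l & dtgt d = w].
Proof.
rewrite /next_vert; case: pickP => //= d /andP[/eqP srcd /eqP labd] [tgtd].
by exists d.
Qed.

Lemma next_vert_dart (X : marked_graph L H) (d : letter (edge X)) :
  folded_graph X -> next_vert (dsrc d) (dlab d) = Some (dtgt d).
Proof.
move=> foldX; rewrite /next_vert; case: pickP => [d' /andP[/eqP s_eq /eqP l_eq]|/(_ d)].
  by rewrite /= (foldX _ _ s_eq l_eq).
by rewrite !eqxx.
Qed.

Lemma next_vert_flip (X : marked_graph L H) (v w : vert X) l :
  folded_graph X -> next_vert v l = Some w -> next_vert w (flip l) = Some v.
Proof.
move=> foldX /next_vertP[d [<- <- <-]].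
by have := next_vert_dart (flip d) foldX; rewrite dtgt_flip.
Qed.

Definition next_pair (p : vert X1 * vert X2) (l : letter L) :=
  if next_vert p.1 l is Some w1 then
    if next_vert p.2 l is Some w2 then Some (w1, w2) else None else None.

Lemma next_pair_flip p l q : next_pair p l = Some q -> next_pair q (flip l) = Some p.
Proof.
rewrite /next_pair; case: p => p1 p2 /=.
case E1: next_vert => [w1|] //; case E2: next_vert => [w2|] // [<-] /=.
by rewrite (next_vert_flip fold1 E1) (next_vert_flip fold2 E2).
Qed.

Lemma run_pair u1 ds1 v1 u2 ds2 v2 : @walk _ _ X1 u1 ds1 v1 -> @walk _ _ X2 u2 ds2 v2 ->
  map (@dlab _ _ X1) ds1 = map (@dlab _ _ X2) ds2 ->
  run next_pair (u1, u2) (map (@dlab _ _ X1) ds1) = Some (v1, v2).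
Proof.
elim: ds1 u1 u2 ds2 => [|d1 ds1 IHds] u1 u2 [|d2 ds2] //=.
  by move=> /eqP-> /eqP->.
move=> /andP[/eqP<- walk1] /andP[/eqP<- walk2] [l_eq b_eq words_eq].
have lab_eq : dlab d1 = dlab d2 by rewrite /dlab l_eq b_eq.
rewrite /next_pair /= (next_vert_dart d1 fold1) lab_eq (next_vert_dart d2 fold2).
exact: IHds walk1 walk2 words_eq.
Qed.

Definition dart_source (o : bool) (p : edge X1 * edge X2) : vert X1 * vert X2 :=
  (dsrc (p.1, o), dsrc (p.2, o)).

Definition darts_from (o : bool) (B : seq (vert X1 * vert X2)) : {set edge X1 * edge X2} :=
  [set p in edge_pairs | dart_source o p \in B].

Lemma dart_source_inj o p q : p \in edge_pairs -> q \in edge_pairs ->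
  lab p.1 = lab q.1 -> dart_source o p = dart_source o q -> p = q.
Proof.
case: p q => [p1 p2] [q1 q2]; rewrite !inE /= => /and3P[/eqP lab_p _ _] /and3P[/eqP lab_q _ _].
move=> lab_pq [src1 src2].
have lab_pq2 : lab p2 = lab q2 by rewrite -lab_p -lab_q.
have [-> //] : (p1, o) = (q1, o) by apply: fold1; rewrite // /dlab /= lab_pq.
by have [->] : (p2, o) = (q2, o) by apply: fold2; rewrite // /dlab /= lab_pq2.
Qed.

(** For each orientation o, the relation of an edge with source in B determines the
    relation of that source: keep the edges with a given letter and replace each
    by its source. A dependence between edges would thus give one between
    vertices of B, since in a folded graph an edge is known from its source and
    letter. *)
Lemma card_darts_from o (B : seq (vert X1 * vert X2)) :
  free (map glue_vert B) -> (#|darts_from o B| <= \dim edge_relations)%N.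
Proof.
move=> free_B.
suff free_darts : free (map glue_edge (enum (darts_from o B))).
  rewrite cardE -(size_map glue_edge) -(eqP (free_darts : \dim _ == _)).
  apply/dimvS/sub_span => _ /mapP[p + ->]; rewrite mem_enum inE => /andP[p_edge _].
  by apply: map_f; rewrite mem_enum.
apply/free_mapP => [|k k0 q]; first exact: enum_uniq.
rewrite mem_enum => q_in.
pose S := extend (fun x : E => if elab x == lab q.1 then
  vert_vec (match x with inl y => inl (dsrc (y, o)) | inr y => inr (dsrc (y, o)) end)
  else 0).
pose s := [seq p <- enum (darts_from o B) | lab p.1 == lab q.1].
have sP p : p \in s -> [/\ p \in edge_pairs, dart_source o p \in B & lab p.1 = lab q.1].
  by rewrite mem_filter mem_enum inE => /andP[/eqP-> /andP[]].
have uniq_s : uniq s by rewrite filter_uniq ?enum_uniq.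
have free_s : free (map (glue_vert \o dart_source o) s).
  rewrite map_comp; apply: (free_map_sub free_B).
    rewrite map_inj_in_uniq // => p p' /sP[p_edge _ lab_p] /sP[p'_edge _ lab_p'].
    by apply: dart_source_inj => //; rewrite lab_p.
  by move=> _ /mapP[p /sP[_ pB _] ->].
apply: (iffRL (free_mapP _ uniq_s) free_s k) => //.
  have := congr1 S k0; rewrite linear0 linear_sum /= => S0.
  rewrite -[RHS]S0 /s [LHS]big_filter big_mkcond /=; apply: eq_big_seq => p.
  rewrite mem_enum !inE => /andP[/and3P[/eqP lab_p _ _] _].
  have Sp : S (glue_edge p) = if lab p.1 == lab q.1 then glue_vert (dart_source o p) else 0.
    rewrite /glue_edge linearB /= !extendE /= -lab_p.
    by case: eqP => _; rewrite ?subr0.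
  by rewrite linearZ /= Sp; case: eqP => _; rewrite ?scaler0.
by rewrite mem_filter eqxx mem_enum.
Qed.

Lemma glue_vert_neq0 p : glue_vert p != 0.
Proof.
rewrite subr_eq0; apply/eqP => /rowP/(_ (enum_rank (inl (inl p.1) : T))).
rewrite !mxE !eqxx /= (inj_eq enum_rank_inj) /=.
by move/eqP; rewrite oner_eq0.
Qed.

(** Take a basis B of the vertex relations that contains the branching vertex c0.
    The exits at the vertices of B number more than 2|B|. By [card_darts_from],
    those along positive letters form an independent family of edge relations,
    and so do those along negative letters; one of the two families has more than
    |B| members. *)
Lemma branching_relations c0 :
  {in C, forall p, 1 < #|exits next_pair C p|}%N -> c0 \in C ->
  (2 < #|exits next_pair C c0|)%N ->
  (\dim vert_relations < \dim edge_relations)%N.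
Proof.
move=> two_exits c0C three_exits.
have free_c0 : free (map glue_vert [:: c0]) by rewrite seq1_free glue_vert_neq0.
have [B [c0B BC free_B spanB]] := extend_free (enum C) free_c0.
have {}c0B : c0 \in B by rewrite c0B ?mem_head.
have {}BC b : b \in B -> b \in C.
  by move/BC; rewrite !inE mem_enum => /orP[/eqP->|].
have uniq_B : uniq B by apply: map_uniq (free_uniq free_B).
have dim_le : (\dim vert_relations <= size B)%N.
  rewrite -(size_map glue_vert); apply: leq_trans (dim_span _); apply: dimvS.
  by apply/span_subvP => _ /mapP[p p_in ->]; apply: spanB.
pose Q : {set (vert X1 * vert X2) * letter L} :=
  [set x | (x.1 \in B) && (x.2 \in exits next_pair C x.1)].
have cardQ : #|Q| = (\sum_(b <- B) #|exits next_pair C b|)%N.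
  rewrite -sum1_card big_uniq //=.
  under [RHS]eq_bigr do rewrite -sum1_card.
  by rewrite pair_big_dep; apply: eq_bigl => x; rewrite inE.
have leQ : (#|Q| <= #|darts_from true B| + #|darts_from false B|)%N.
  pose f o p := (dart_source o p, (lab p.1, o)).
  have sub : Q \subset (f true @: darts_from true B) :|: (f false @: darts_from false B).
    apply/subsetP => -[[v1 v2] [l o]]; rewrite !inE /= => /andP[vB].
    rewrite /next_pair /=; case E1: next_vert => [w1|] //; case E2: next_vert => [w2|] //.
    move: E1 E2 => /next_vertP[[x1 o1] [src1 [lab1 o1E] tgt1]].
    move=> /next_vertP[[x2 o2] [src2 [lab2 o2E] tgt2]] wC; subst o1 o2.
    have x_in : (x1, x2) \in darts_from o B.
      rewrite !inE /= lab1 lab2 eqxx /dart_source /= src1 src2 vB andbT /=.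
      move: (BC _ vB) wC; rewrite -src1 -src2 -tgt1 -tgt2 /dtgt /dsrc /=.
      by case: o {src1 src2 tgt1 tgt2} => /= -> ->.
    have fx : ((v1, v2), (l, o)) = f o (x1, x2) by rewrite /f /dart_source /= src1 src2 lab1.
    by rewrite fx; case: o {src1 src2 tgt1 tgt2 fx} x_in => x_in; rewrite imset_f ?orbT.
  apply: leq_trans (subset_leq_card sub) _; rewrite cardsU.
  apply: leq_trans (leq_subr _ _) _.
  by apply: leq_add; apply: leq_imset_card.
have sum_ge : (\sum_(b <- B) #|exits next_pair C b| > (size B).*2)%N.
  rewrite (big_rem c0) //= (perm_size (perm_to_rem c0B)) /= doubleS.
  have : ((size (rem c0 B)).*2 <= \sum_(b <- rem c0 B) #|exits next_pair C b|)%N.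
    rewrite -mul2n -sum1_size big_distrr /= big_seq [leqRHS]big_seq.
    by apply: leq_sum => b /mem_rem/BC/two_exits.
  exact: leq_add three_exits.
have := card_darts_from true free_B; have := card_darts_from false free_B.
rewrite cardQ in leQ; lia.
Qed.

End Branching.

Hypotheses (conn1 : connected_graph X1) (conn2 : connected_graph X2).
Hypothesis C0 : C != set0.
Hypothesis loops_generate : forall (K : groupType) (h : L -> K),
  kills_loops X1 h -> kills_loops X2 h ->
  forall l, h l = 1%g.

(** Let P be a linear map whose kernel is the space in question. The images under
    P of the letters form a map h from the letters to an abelian group, and the
    images of the vertices form a potential for it, so h vanishes on closed
    walks and is trivial by assumption. Hence P takes a single value on the
    vertices of each Xi, the same for both as C is not empty, and its rank is at
    most 1. *)
Lemma dim_boundary_ge :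
  (#|vert X1| + #|vert X2| + #|L| <= \dim (limg boundary + vert_relations) + 1)%N.
Proof.
have [P kerP] := lker_exists (limg boundary + vert_relations).
have [[c1 c2] cC] := set0Pn _ C0.
have kerB x : P (boundary x) = 0.
  by apply/eqP; rewrite -memv_ker kerP; apply/(subvP (addvSl _ _))/memv_img/memvf.
have edgeP (x : E) : P (vert_vec (esrc x)) + P (lab_vec (elab x)) = P (vert_vec (etgt x)).
  have := kerB (unit_vec _ x); rewrite /boundary extendE linearB linearD /=.
  by move/eqP; rewrite subr_eq0 => /eqP.
pose W : groupType := 'rV['F_2]_#|T|.
pose h (l : L) : W := P (lab_vec l).
pose p1 (v : vert X1) : W := P (vert_vec (inl v)).
pose p2 (v : vert X2) : W := P (vert_vec (inr v)).
have pot1 u ds v := @walk_potential _ _ X1 W p1 h u ds v (fun x => edgeP (inl x)).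
have pot2 u ds v := @walk_potential _ _ X2 W p2 h u ds v (fun x => edgeP (inr x)).
have h1 : forall l, h l = 1%g.
  apply: loops_generate => ds walk_ds.
    by apply: (mulgI (p1 (base X1))); rewrite mulg1; apply: pot1.
  by apply: (mulgI (p2 (base X2))); rewrite mulg1; apply: pot2.
have wordh s : word_value h s = 1%g.
  elim: s => //= -[l b] s ->; rewrite mulg1 /letter_value /= h1.
  by case: b; rewrite ?invg1.
have p1E v : p1 v = p1 c1.
  have [ds /pot1] := conn1 v; have [ds' /pot1] := conn1 c1.
  by rewrite !wordh !mulg1 => <- <-.
have p2E v : p2 v = p2 c2.
  have [ds /pot2] := conn2 v; have [ds' /pot2] := conn2 c2.
  by rewrite !wordh !mulg1 => <- <-.
have p12 : p1 c1 = p2 c2.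
  apply/eqP; rewrite -subr_eq0 -linearB -memv_ker kerP; apply/(subvP (addvSr _ _)).
  by apply: memv_span; apply/mapP; exists (c1, c2); rewrite ?mem_enum.
have imgP : (limg P <= <[p1 c1]>)%VS.
  apply: subv_trans (limgS P (unit_vec_span 'F_2 T)) _.
  rewrite limg_span; apply/span_subvP => _ /mapP[_ /mapP[t _ ->] ->].
  case: t => [[v|v]|l].
  - by rewrite -/(vert_vec _) -/(p1 v) p1E memv_line.
  - by rewrite -/(vert_vec _) -/(p2 v) p2E -p12 memv_line.
  - by rewrite -/(lab_vec _) -/(h l) h1 mem0v.
have := limg_ker_dim P fullv; rewrite capfv kerP dimvf [dim _]dim_matrix mul1r.
have cardT : #|T| = (#|vert X1| + #|vert X2| + #|L|)%N by rewrite !card_sum.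
move=> dimT; rewrite (esym (etrans dimT cardT)) leq_add2l.
by apply: leq_trans (dimvS imgP) _; rewrite dim_vline leq_b1.
Qed.

Lemma rank_bound :
  (#|vert X1| + #|vert X2| + #|L| + \dim edge_relations <=
   #|edge X1| + #|edge X2| + \dim vert_relations + 1)%N.
Proof. have := dim_boundary_le; have := dim_boundary_ge; lia. Qed.


End RankBound.

(** * The edge group is commutative, hence cyclic *)

Local Close Scope ring_scope.
Local Open Scope group_scope.

Lemma word_value_morph (X : Type) (G K : groupType) (e : X -> G)
    (theta : {multiplicative G -> K}) (h : X -> K) s :
  (forall x, theta (e x) = h x) -> theta (word_value e s) = word_value h s.
Proof.
move=> thetaE; elim: s => [|[x b] s IHs] /=; first by rewrite mult1.
by rewrite gmulfM IHs /letter_value /=; case: b; rewrite ?multV thetaE.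
Qed.

Section Commutativity.
Variables (H1 H2 M G F3 : groupType).
Variables (i1 : {multiplicative M -> H1}) (i2 : {multiplicative M -> H2}).
Variables (j1 : {multiplicative H1 -> G}) (j2 : {multiplicative H2 -> G}).
Variables (p : {multiplicative G -> F3}).
Hypotheses (freeH1 : free_group_of_rank 2 H1) (freeH2 : free_group_of_rank 2 H2).
Hypotheses (inj_i1 : injective i1) (inj_i2 : injective i2).
Hypothesis amalgG : amalgamated_product i1 i2 j1 j2.
Hypotheses (freeF3 : free_group_of_rank 3 F3) (surj_p : surjective_map p).

(** A map that kills both vertex groups kills G, by the uniqueness part of the
    universal property. *)
Lemma images_generate (K : groupType) (theta : {multiplicative F3 -> K}) :
  (forall x, theta (p (j1 x)) = 1) -> (forall y, theta (p (j2 y)) = 1) ->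
  forall g, theta g = 1.
Proof.
move=> theta1 theta2 g; have [a <-] := surj_p g.
have [_ uniq_map] := amalgG.2 K (@one_fun H1 K) (@one_fun H2 K) (fun=> erefl).
exact: (uniq_map (theta \o p) (@one_fun G K)).
Qed.

Lemma edge_group_commutative (m m' : M) : m * m' = m' * m.
Proof.
apply/eqP; apply/negPn/negP => /eqP nmm'.
have [e free_e] := freeF3; have [b1 free_b1] := freeH1; have [b2 free_b2] := freeH2.
pose f1 : {multiplicative H1 -> F3} := p \o j1.
pose f2 : {multiplicative H2 -> F3} := p \o j2.
have [X1 [[conn1 fold1 loops1] card1]] := stallings_graph ord0 free_e f1 free_b1.
have [X2 [[conn2 fold2 loops2] card2]] := stallings_graph ord0 free_e f2 free_b2.
have generate (K : groupType) (h : 'I_3 -> K) :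
  kills_loops X1 h -> kills_loops X2 h ->
  forall l, h l = 1%g.
  move=> h1 h2 l; have [theta thetaE] := (free_e K h).1.
  rewrite -thetaE; apply: images_generate => x.
    have [ds walk_ds value_ds] := loops1 x; rewrite -[p _]/(f1 x) -value_ds.
    by rewrite (word_value_morph _ thetaE) h1.
  have [ds walk_ds value_ds] := loops2 x; rewrite -[p _]/(f2 x) -value_ds.
  by rewrite (word_value_morph _ thetaE) h2.
have bound (C : {set vert X1 * vert X2}) : C != set0 ->
    (#|vert X1| + #|vert X2| + 3 + \dim (@edge_relations _ _ X1 X2 C) <=
     #|edge X1| + #|edge X2| + \dim (@vert_relations _ _ X1 X2 C) + 1)%N.
  move=> C0; have := rank_bound conn1 conn2 C0 generate.
  by have -> : #|'I_3| = 3 by rewrite card_ord.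
have f12 x : f1 (i1 x) = f2 (i2 x) by rewrite /f1 /f2 /= amalgG.1.
have [inj_f|no_inj] : injective (f1 \o i1) \/ ~ (injective f1 \/ injective f2).
- have [[inj1|inj2]|] := classic (injective f1 \/ injective f2); last by right.
    by left; apply: inj_comp.
  left; apply: (eq_inj (f := f2 \o i2)); first exact: inj_comp.
  by move=> x; exact: esym (f12 x).
- have reduced_loop x : exists s, [/\ reduced s, word_value e s = f1 (i1 x) &
      run (@next_pair _ _ X1 X2) (base X1, base X2) s = Some (base X1, base X2)].
    have [ds1 /walk_reduce walk1 val1] := loops1 (i1 x).
    have [ds2 /walk_reduce walk2 val2] := loops2 (i2 x).
    set rs1 := mul_word ds1 [::] in walk1; set rs2 := mul_word ds2 [::] in walk2.
    have red1 : reduced rs1 by apply: mul_word_reduced.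
    have red2 : reduced rs2 by apply: mul_word_reduced.
    have redw1 := folded_reduced fold1 walk1 red1.
    have redw2 := folded_reduced fold2 walk2 red2.
    have valE (X : marked_graph 'I_3 F3) ds :
        word_value e (map (@dlab _ _ X) (mul_word ds [::])) =
        word_value e (map (@dlab _ _ X) ds).
      have labE ds' : word_value e (map (@dlab _ _ X) ds') = word_value (e \o @lab _ _ X) ds'.
        by elim: ds' => //= d ds' ->.
      by rewrite !labE word_value_mul mulg1.
    exists (map (@dlab _ _ X1) rs1); split=> //; first by rewrite valE.
    apply: run_pair walk1 walk2 _ => //.
    by apply: (free_basis_inj free_e) => //; rewrite !valE val1 val2.
  have [a [reda vala runa]] := reduced_loop m.
  have [b [redb valb runb]] := reduced_loop m'.
  have nab : ~ commute (word_value e a) (word_value e b).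
    rewrite vala valb /commute -!gmulfM => eq_f.
    by apply: nmm'; apply: inj_f; exact: eq_f.
  have [C [two [c cC three]]] :=
    branching_set (next_pair_flip fold1 fold2) reda redb runa runb nab.
  have C0 : C != set0 by apply/set0Pn; exists c.
  have lt_dim := branching_relations fold1 fold2 two cC three.
  have {bound} := bound C C0.
  have le1 : (#|edge X1| <= #|vert X1| + 1)%N by case: card1 => [|[]]; lia.
  have le2 : (#|edge X2| <= #|vert X2| + 1)%N by case: card2 => [|[]]; lia.
  by move: lt_dim le1 le2; clear; lia.
(* Gluing at the base vertices alone: one vertex relation and no edge relation. *)
pose C := [set (base X1, base X2)].
have C0 : C != set0 by apply/set0Pn; exists (base X1, base X2); rewrite inE.
have {bound} := bound C C0.
have le1 : (#|edge X1| <= #|vert X1|)%N.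
  by case: card1 => [|[_ inj1]]; [lia | case: no_inj; left].
have le2 : (#|edge X2| <= #|vert X2|)%N.
  by case: card2 => [|[_ inj2]]; [lia | case: no_inj; right].
have dimC : (\dim (@vert_relations _ _ X1 X2 C) <= 1)%N.
  apply: leq_trans (dim_span _) _.
  by rewrite size_map -cardE cards1.
move: le1 le2 dimC; clear; lia.
Qed.

End Commutativity.

Lemma word_value_power (X : Type) (G : groupType) (e : X -> G) g s :
  (forall x, e x = g) -> exists n, word_value e s = g ^+ n \/ word_value e s = g ^- n.
Proof.
move=> eE; elim: s => [|[x b] s [n IHs]] /=; first by exists 0%N; left.
rewrite /letter_value /= eE; case: b IHs => -[->|->].
- by exists n.+1; left; rewrite expgS.
- case: n => [|n]; first by exists 1%N; left; rewrite expg0 invg1 mulg1 expg1.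
  by exists n; right; rewrite expgSr invgM mulVKg.
- case: n => [|n]; first by exists 1%N; right; rewrite expg0 mulg1 expg1.
  by exists n; left; rewrite expgS mulKg.
- by exists n.+1; right; rewrite expgSr invgM.
Qed.

(** Two distinct basis elements could be sent to two transpositions of 'S_3 that
    do not commute, so a commutative free group has at most one basis element. *)
Lemma commutative_free_cyclic (M : groupType) :
  free_group M -> (forall m m' : M, m * m' = m' * m) ->
  cyclic_group M \/ trivial_group M.
Proof.
case=> X [e free_e] commM.
have [[x0 _]|noX] := classic (exists x : X, True); last first.
  right => m; apply: ((free_e M e).2 idfun (@one_fun M M)) => // x; case: noX; by exists x.
left; exists (e x0).
have eqX x : x = x0.
  apply: NNPP => xx0.
  pose s : 'S_3 := tperm (inord 0) (inord 1); pose t : 'S_3 := tperm (inord 1) (inord 2).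
  pose f x := if excluded_middle_informative (x = x0) then s else t.
  have [phi phiE] := (free_e _ f).1.
  have fx0 : f x0 = s by rewrite /f; case: (excluded_middle_informative (x0 = x0)).
  have fx : f x = t by rewrite /f; case: (excluded_middle_informative (x = x0)).
  have := congr1 phi (commM (e x0) (e x)); rewrite !gmulfM !phiE fx0 fx.
  move=> /permP/(_ (inord 0)); rewrite !permM tpermL [t (inord 0)]tpermD; last 2 first.
  - by rewrite -val_eqE /= !inordK.
  - by rewrite -val_eqE /= !inordK.
  rewrite !tpermL => /(congr1 val); rewrite /= !inordK //.
have free_e' : free_basis (fun _ : 'I_1 => e x0).
  move=> K f; have [[phi phiE] phi_uniq] := free_e K (fun=> f ord0).
  split; first by exists phi => i; rewrite phiE (ord1 i).
  by move=> phi1 phi2 E1 E2; apply: phi_uniq => x; rewrite (eqX x) ?E1 ?E2.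
move=> m; have [s _ ->] := free_basis_surj free_e' m.
exact: word_value_power.
Qed.

Theorem theorem1p1 (H1 H2 M G F3 : groupType)
  (i1 : {multiplicative M -> H1}) (i2 : {multiplicative M -> H2})
  (j1 : {multiplicative H1 -> G}) (j2 : {multiplicative H2 -> G})
  (freeH1 : free_group_of_rank 2 H1) (freeH2 : free_group_of_rank 2 H2)
  (freeM : free_group M)
  (inj_i1 : injective i1) (inj_i2 : injective i2)
  (amalgG : amalgamated_product i1 i2 j1 j2)
  (freeF3 : free_group_of_rank 3 F3) :
  (exists p : {multiplicative G -> F3}, surjective_map p) ->
  cyclic_group M \/ trivial_group M.
Proof.
case=> p surj_p; apply: commutative_free_cyclic freeM _.
exact: (edge_group_commutative freeH1 freeH2 inj_i1 inj_i2 amalgG freeF3 surj_p).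
Qed.
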